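(* Let $a,b,q,p$ be complex numbers with $a,b,q\neq 0$ and $|p|<1$, chosen such that non-removable singularities and poles are avoided in the expressions below (so that both sides make sense, values at removable singularities being understood by continuity). For every non-negative integer $n$, $$\sum_{k=0}^{n} W_{a,b;q,p}(k)\Big([k+1]_{a,b;q,p}\,[2]_{aq^{2k},\,bq^{k};q,p}-1\Big) =W_{a,b;q,p}(1)\,[n+1]_{a,b;q,p}\,[n+1]_{aq^2,\,bq;q,p}.$$
   Context: For $|p|<1$ and complex $x\neq 0$, the modified Jacobi theta function is $\theta(x;p):=\prod_{j=0}^\infty (1-xp^j)(1-p^{j+1}/x)$, and $\theta(x_1,\dots,x_r;p):=\theta(x_1;p)\cdots\theta(x_r;p)$. (For $p=0$, $\theta(x;0)=1-x$.) The elliptic number is $$[z]_{a,b;q,p}:=\frac{\theta(q^z,aq^z,bq^2,a/b;p)}{\theta(q,aq,bq^{z+1},aq^{z-1}/b;p)}$$ and the elliptic weight is $$W_{a,b;q,p}(k):=\frac{\theta(aq^{2k+1},bq,bq^2,aq^{-1}/b,a/b;p)}{\theta(aq,bq^{k+1},bq^{k+2},aq^{k-1}/b,aq^k/b;p)}\,q^k.$$ When subscripts such as $aq^{2k},bq^{k}$ appear, they replace $a,b$ in these definitions. *)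

(* Defs.v *)
From HB Require Import structures.
From mathcomp Require Export all_boot all_order all_algebra.
From mathcomp Require Export complex.
From mathcomp Require Export all_classical all_reals all_analysis.
Set Implicit Arguments.
Unset Strict Implicit.
Unset Printing Implicit Defensive.
Export Order.TTheory GRing.Theory Num.Theory.
Export numFieldNormedType.Exports.
Local Open Scope classical_set_scope.
Local Open Scope ring_scope.

Section EllipticFunctions.
(* The intended instance is K := R[i] with R : realType, where the product
   defining theta1 converges for |p| < 1.  The topology on K is the one that
   numFieldNormedType derives from the norm. *)
Variable K : numFieldType.

Definition theta1 (x p : K) : K :=
  lim ((fun m : nat =>
          \prod_(0 <= j < m) ((1 - x * p ^+ j) * (1 - p ^+ j.+1 / x))) @ \oo).

Definition theta (xs : seq K) (p : K) : K := \prod_(x <- xs) theta1 x p.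

(* Numerators and denominators are named separately because the vanishing of
   a denominator is what delimits the domain of the formulas. *)
Definition ellnum_num (z : int) (a b q p : K) : K :=
  theta [:: q ^ z; a * q ^ z; b * q ^+ 2; a / b] p.
Definition ellnum_den (z : int) (a b q p : K) : K :=
  theta [:: q; a * q; b * q ^ (z + 1); a * q ^ (z - 1) / b] p.
Definition ellnum (z : int) (a b q p : K) : K :=
  ellnum_num z a b q p / ellnum_den z a b q p.

Definition ellwt_num (k : int) (a b q p : K) : K :=
  theta [:: a * q ^ (2 * k + 1); b * q; b * q ^+ 2; a * q^-1 / b; a / b] p.
Definition ellwt_den (k : int) (a b q p : K) : K :=
  theta [:: a * q; b * q ^ (k + 1); b * q ^ (k + 2);
            a * q ^ (k - 1) / b; a * q ^ k / b] p.
Definition ellwt (k : int) (a b q p : K) : K :=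
  ellwt_num k a b q p / ellwt_den k a b q p * q ^ k.

(* The tuple (a, b, q, p), with the product topology. *)
Local Notation params := (K * K * K * K)%type.

Definition admissible (w : params) : Prop :=
  let: (a, b, q, p) := w in [/\ a != 0, b != 0, q != 0 & `|p| < 1].

Definition lhs (n : nat) (w : params) : K :=
  let: (a, b, q, p) := w in
  \sum_(0 <= k < n.+1)
    ellwt k a b q p *
    (ellnum k.+1 a b q p * ellnum 2 (a * q ^+ (2 * k)) (b * q ^+ k) q p - 1).

Definition rhs (n : nat) (w : params) : K :=
  let: (a, b, q, p) := w in
  ellwt 1 a b q p * ellnum n.+1 a b q p * ellnum n.+1 (a * q ^+ 2) (b * q) q p.

(* Where the formula for lhs n (resp. rhs n) involves no division by 0. *)
Definition lhs_dom (n : nat) : set params :=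
  [set w | admissible w /\
    let: (a, b, q, p) := w in
    forall k : nat, (k <= n)%N ->
      [/\ ellwt_den k a b q p != 0,
          ellnum_den k.+1 a b q p != 0 &
          ellnum_den 2 (a * q ^+ (2 * k)) (b * q ^+ k) q p != 0]].

Definition rhs_dom (n : nat) : set params :=
  [set w | admissible w /\
    let: (a, b, q, p) := w in
    [/\ ellwt_den 1 a b q p != 0,
        ellnum_den n.+1 a b q p != 0 &
        ellnum_den n.+1 (a * q ^+ 2) (b * q) q p != 0]].

(* A function f given by a formula valid on D "makes sense" at w if w is in D
   or w is a removable singularity, i.e. f has a finite limit at w along D,
   jointly in the four parameters; its value at a removable singularity is
   that limit. *)
Definition makes_sense (D : set params) (f : params -> K)
    (w : params) : Prop :=
  D w \/ cvg (f v @[v --> within D (nbhs w)]).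

Definition value (D : set params) (f : params -> K)
    (w : params) : K :=
  if w \in D then f w else lim (f v @[v --> within D (nbhs w)]).

End EllipticFunctions.

(* Main.v *)
Require Import Defs.
From mathcomp Require Import ring zify.
Set Implicit Arguments.
Unset Strict Implicit.
Unset Printing Implicit Defensive.
Local Open Scope classical_set_scope.
Local Open Scope ring_scope.
Local Open Scope complex_scope.

(** For generic parameters the identity telescopes: the k-th summand equals
    W(1) ([k+1] [k+1]' - [k] [k]'), where the prime replaces (a, b) by
    (a q^2, b q), and after clearing denominators this is a combination of two
    instances of the Weierstrass three-term relation for theta.  That relation
    holds because the finite Jacobi triple product writes theta(xy) theta(x/y)
    as a limit of c (A(x) B(y) - (x/y) B(x) A(y)), so that, up to the factor x,
    it is an antisymmetric form of rank 2, for which the three-term relation is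
    a Pluecker relation.  Since theta is jointly continuous and has isolated
    zeros, generic parameters are dense, and both sides at an arbitrary point,
    removable singularities included, are limits along generic parameters. *)

(** Both three-term instances behind one summand have a right-hand side divisible by theta(q^(1-k);
    p) theta(a q^(k+1); p). This common part is neither in the summand nor in the telescoped
    difference, and the combination of the two instances is the one that cancels it. One of the
    instances pairs a with b, and its arguments become products and quotients of two numbers only
    after a square root of a is taken; hence the second standing hypothesis on the field, closure
    under square roots. The two sides of the identity are singular on different sets, so their
    values at a bad point are limits along two different domains. They become comparable on a set
    that lies in both domains and accumulates at every admissible point. *)

(* The only form of completeness used; it is a hypothesis on a numFieldType
   because that is the structure whose topology the definitions refer to. *)
Definition geometric_complete (K : numFieldType) : Prop :=
  forall (u : nat -> K) (C r : K), 0 <= r -> r < 1 ->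
    (forall m k, `|u (m + k)%N - u m| <= C * r ^+ m) ->
  exists l : K, u @ \oo --> l /\ forall m, `|l - u m| <= C * r ^+ m.

(** * Completeness of the complex numbers *)

Section ComplexComplete.
Variable R : realType.
Local Notation Re := (@complex.Re R).
Local Notation Im := (@complex.Im R).

Lemma ger0_Re (x : R[i]) : 0 <= x -> x = (Re x)%:C.
Proof. by rewrite lecE /=; case: x => a b /= /andP[/eqP -> _]. Qed.

Lemma normc_le_ReIm (x : R[i]) : `|x| <= (`|Re x| + `|Im x|)%:C.
Proof.
rewrite normc_def lecR -ler_sqr ?nnegrE ?sqrtr_ge0 ?addr_ge0//.
rewrite sqr_sqrtr ?addr_ge0 ?sqr_ge0// sqrrD !real_normK ?num_real//.
by rewrite lerD2r lerDl mulrn_wge0// mulr_ge0.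
Qed.

Lemma normc_ge_Im (x : R[i]) : `|Im x|%:C <= `|x|.
Proof. by rewrite normc_def lecR -sqrtr_sqr ler_wsqrtr// lerDr sqr_ge0. Qed.

Lemma real_geometric_cauchy_cvg (u : nat -> R) (C r : R) : 0 <= r -> r < 1 ->
  (forall m k, `|u (m + k)%N - u m| <= C * r ^+ m) -> cvgn u.
Proof.
move=> r0 r1 hu; apply/cauchy_cvgP/cauchy_exP => e e0.
have : (fun n : nat => C * r ^+ n) @ \oo --> (0 : R).
  rewrite -[X in _ --> X](mulr0 C); apply: cvgM; first exact: cvg_cst.
  by apply: cvg_expr; rewrite ger0_norm.
move/cvgrPdist_lt => /(_ _ e0) [N _ NP].
exists (u N); exists N => // n /= Nn; rewrite /ball /= distrC.
rewrite -(subnKC Nn); apply: le_lt_trans (hu _ _) _.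
by have := NP N (leqnn _); rewrite sub0r normrN; exact: le_lt_trans (ler_norm _).
Qed.

(** In the order of [R[i]] a number above 0 is real, so [C] and [r] are real and the Cauchy bound
    descends to real and imaginary parts. *)
Lemma complex_geometric_complete : geometric_complete (R[i] : numFieldType).
Proof.
move=> u C r r0 r1 hu.
have C0 : 0 <= C.
  by have := hu 0 0; rewrite addn0 subrr normr0 expr0 mulr1.
have rE := ger0_Re r0; have CE := ger0_Re C0.
have Rr0 : 0 <= Re r by rewrite -lecR -rE.
have Rr1 : Re r < 1 by rewrite -ltcR -rE.
have bE m : C * r ^+ m = (Re C * Re r ^+ m)%:C.
  by rewrite rmorphM rmorphXn /= -rE -CE.
have cRe : cvgn (fun n => Re (u n)).
  apply: (@real_geometric_cauchy_cvg _ (Re C) _ Rr0 Rr1) => m k.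
  rewrite -lecR -bE.
  by apply: le_trans (hu m k); rewrite -raddfB normc_ge_Re.
have cIm : cvgn (fun n => Im (u n)).
  apply: (@real_geometric_cauchy_cvg _ (Re C) _ Rr0 Rr1) => m k.
  rewrite -lecR -bE.
  by apply: le_trans (hu m k); rewrite -raddfB normc_ge_Im.
pose l : (R[i] : numFieldType) :=
  (limn (fun n => Re (u n))) +i* (limn (fun n => Im (u n))).
have ul : u @ \oo --> l.
  apply/cvgrPdist_lt => e e0; have eE := ger0_Re (ltW e0).
  have Re0 : 0 < Re e / 2 by rewrite divr_gt0// -ltcR -eE.
  have /cvgrPdist_lt /(_ _ Re0) h1 := cRe.
  have /cvgrPdist_lt /(_ _ Re0) h2 := cIm.
  near=> n; apply: le_lt_trans (normc_le_ReIm _) _.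
  rewrite !raddfB /= eE ltcR (splitr (Re e)) ltrD//; near: n; [exact: h1|exact: h2].
exists l; split=> // m; apply/ler_addgt0Pr => e e0.
have /cvgrPdist_lt /(_ _ e0) [N _ NP] := ul.
rewrite -(subrKA (u (m + N)%N)) (le_trans (ler_normD _ _))// addrC lerD//.
by apply/ltW/NP; rewrite /= leq_addl.
Unshelve. all: end_near.
Qed.
End ComplexComplete.

(** * Infinite products and the theta function *)

Section Products.
Variable K : numFieldType.
Hypothesis Kcomplete : geometric_complete K.

(** [K] is not assumed archimedean, so this too comes from completeness: the powers satisfy the
    Cauchy bound with [C = 1], and their limit [l] satisfies [l = r * l]. *)
Lemma cvg_expr0 (r : K) : 0 <= r -> r < 1 ->
  (fun n : nat => r ^+ n) @ \oo --> (0 : K).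
Proof.
move=> r0 r1.
have [m k|l [ul _]] := Kcomplete (u := fun n => r ^+ n) (C := 1) r0 r1.
  rewrite mul1r distrC exprD -{1}[r ^+ m]mulr1 -mulrBr.
  rewrite normrM ger0_norm ?exprn_ge0// ler_piMr ?exprn_ge0//.
  have rk : 0 <= r ^+ k by rewrite exprn_ge0.
  have rk1 : r ^+ k <= 1 by rewrite exprn_ile1// ltW.
  by rewrite ger0_norm ?subr_ge0// gerBl.
suff -> : 0 = l by [].
have h1 : (fun n : nat => r * r ^+ n) @ \oo --> l.
  by have := ul; rewrite -cvg_shiftS; under eq_fun do rewrite exprS.
have h2 : (fun n : nat => r * r ^+ n) @ \oo --> r * l.
  by apply: cvgM => //; exact: cvg_cst.
have lE := cvg_unique (@norm_hausdorff _ _) h1 h2.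
apply/esym/eqP; have : l * (1 - r) == 0 by rewrite mulrBr mulr1 mulrC {1}lE subrr.
by rewrite mulf_eq0 subr_eq0 => /orP[//|/eqP r1E]; rewrite -r1E ltxx in r1.
Qed.


Lemma sum_expr_le (r : K) m n : 0 <= r -> r < 1 ->
  \sum_(m <= j < n) r ^+ j <= r ^+ m / (1 - r).
Proof.
move=> r0 r1; have r1' : 0 < 1 - r by rewrite subr_gt0.
rewrite ler_pdivlMr//; have [nm|mn] := leqP n m.
  by rewrite big_geq// mul0r exprn_ge0.
rewrite -(subnKC (ltnW mn)); elim: (n - m)%N => [|k IH].
  by rewrite addn0 big_geq// mul0r exprn_ge0.
suff -> : (\sum_(m <= j < m + k.+1) r ^+ j) * (1 - r) = r ^+ m - r ^+ (m + k.+1).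
  by rewrite gerBl exprn_ge0.
elim: k {IH} => [|k IH].
  by rewrite addn1 big_nat1 exprSr mulrBr mulr1.
rewrite addnS big_nat_recr/= ?leq_addr// mulrDl IH [in RHS]exprSr mulrBr mulr1.
by rewrite subrKA.
Qed.

(** The Weierstrass product inequality; it keeps tails of products away from 0. *)
Lemma prod_ge_1Bsum (u : nat -> K) m n : \sum_(m <= j < n) `|u j| <= 1 ->
  1 - \sum_(m <= j < n) `|u j| <= `|\prod_(m <= j < n) (1 + u j)|.
Proof.
have [nm|mn] := leqP n m; first by rewrite !big_geq// subr0 normr1.
rewrite -(subnKC (ltnW mn)); elim: (n - m)%N => [|k IH].
  by rewrite addn0 !big_geq// subr0 normr1.
rewrite addnS !big_nat_recr/= ?leq_addr//.
set S := \sum_(m <= _ < _) _ in IH *; set P := \prod_(m <= _ < _) _ in IH *.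
set v := u _; move=> S1.
have S0 : 0 <= S by rewrite sumr_ge0.
have v0 := normr_ge0 v.
have v1 : `|v| <= 1 by apply: le_trans S1; rewrite lerDr.
have Sle1 : S <= 1 by apply: le_trans S1; rewrite lerDl.
rewrite normrM; apply: (@le_trans _ _ ((1 - S) * (1 - `|v|))).
  have -> : (1 - S) * (1 - `|v|) = 1 - (S + `|v|) + S * `|v| by ring.
  by rewrite lerDl mulr_ge0.
apply: ler_pM; rewrite ?subr_ge0 ?IH//.
by have := lerB_normD 1 v; rewrite normr1.
Qed.

(** Stands in for the bound of a product by an exponential: each step uses (1 + w)(1 - S - w) <= 1 -
    S. *)
Lemma prod_le_1Bsum (v : nat -> K) m n : (forall j, 0 <= v j) ->
  (\prod_(m <= j < n) (1 + v j)) * (1 - \sum_(m <= j < n) v j) <= 1.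
Proof.
move=> v0; have [nm|mn] := leqP n m; first by rewrite !big_geq// subr0 mulr1.
rewrite -(subnKC (ltnW mn)); elim: (n - m)%N => [|k IH].
  by rewrite addn0 !big_geq// subr0 mulr1.
rewrite addnS !big_nat_recr/= ?leq_addr//; apply: le_trans IH.
rewrite -mulrA ler_wpM2l//.
  by apply: prodr_ge0 => j _; rewrite addr_ge0.
set S := \sum_(m <= _ < _) _; set w := v _.
have -> : (1 + w) * (1 - (S + w)) = 1 - S - w * (S + w) by ring.
by rewrite gerBl mulr_ge0 ?addr_ge0 ?v0// sumr_ge0.
Qed.

Lemma geometric_small (C r e : K) : 0 <= r -> r < 1 -> 0 < e ->
  \forall m \near \oo, `|C * r ^+ m| < e.
Proof.
move=> r0 r1 e0.
have : (fun m : nat => C * r ^+ m) @ \oo --> (0 : K).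
  rewrite -[X in _ --> X](mulr0 C); apply: cvgM; first exact: cvg_cst.
  exact: cvg_expr0.
by move/cvgrPdist_lt => /(_ _ e0); apply: filterS => m; rewrite sub0r normrN.
Qed.

(* The constants M and J depend only on the majorant U r^j of the factors: this
   uniformity is what makes theta1 continuous and its zeros isolated. *)
Lemma infprod (U r : K) : 0 <= U -> 0 <= r -> r < 1 ->
  exists M J, forall u : nat -> K, (forall j, `|u j| <= U * r ^+ j) ->
  exists l, [/\ (fun n => \prod_(0 <= j < n) (1 + u j)) @ \oo --> l,
    forall m, `|l - \prod_(0 <= j < m) (1 + u j)| <= M * r ^+ m &
    (forall j, (j < J)%N -> 1 + u j != 0) -> l != 0].
Proof.
move=> U0 r0 r1; have r1' : 0 < 1 - r by rewrite subr_gt0.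
have half1B : 2^-1 = 1 - 2^-1 :> K by field.
have [J hJ] : exists J, U * (r ^+ J / (1 - r)) <= 2^-1.
  have [N _ NP] := @geometric_small (U / (1 - r)) r 2^-1 r0 r1 (ltac:(by [])).
  exists N; have := NP _ (leqnn _); rewrite mulrA mulrAC => h.
  apply/ltW/(le_lt_trans _ h)/real_ler_norm.
  by rewrite ger0_real// !mulr_ge0 ?exprn_ge0 ?invr_ge0// ltW.
have sumJ n : \sum_(J <= j < n) U * r ^+ j <= 2^-1.
  by rewrite -mulr_sumr (le_trans _ hJ)// ler_wpM2l// sum_expr_le.
(* The tail from [J] sums to at most 1/2, so its product is at most 1/(1 - 1/2) = 2. *)
pose B := \prod_(0 <= j < J) (1 + U * r ^+ j) * 2.
have v0 j : 0 <= U * r ^+ j by rewrite mulr_ge0 ?exprn_ge0.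
have p0 m n : 0 <= \prod_(m <= j < n) (1 + U * r ^+ j).
  by apply: prodr_ge0 => j _; rewrite addr_ge0.
have B0 : 0 <= B by rewrite mulr_ge0.
have bndB n : \prod_(0 <= j < n) (1 + U * r ^+ j) <= B.
  have [Jn|nJ] := leqP J n.
    rewrite (big_cat_nat _ Jn)//= ler_wpM2l//.
    have := @prod_le_1Bsum (fun j => U * r ^+ j) J n v0.
    set P := \prod_(_ <= _ < _) _ ; set S := \sum_(_ <= _ < _) _ => h.
    have S2 : S <= 2^-1 by exact: sumJ.
    have h1 : P * 2^-1 <= 1.
      apply: le_trans h; rewrite ler_wpM2l ?p0//.
      by rewrite half1B lerD2l lerN2.
    by rewrite -[X in _ <= X]mul1r -ler_pdivrMr.
  have PJ : \prod_(0 <= j < n) (1 + U * r ^+ j) <= \prod_(0 <= j < J) (1 + U * r ^+ j).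
    rewrite [X in _ <= X](big_cat_nat _ (ltnW nJ))//= ler_peMr//.
    apply: (big_ind (fun x => 1 <= x)) => // [x y x1 y1|j _]; last by rewrite lerDl.
    by rewrite -[1]mulr1 ler_pM.
  by apply: (le_trans PJ); rewrite ler_peMr// ler1n.
exists (B * U / (1 - r)), J => u hu.
pose P n := \prod_(0 <= j < n) (1 + u j).
have bndP n : `|P n| <= B.
  apply: le_trans (bndB n); rewrite normr_prod; apply: ler_prod => j _.
  by rewrite normr_ge0 (le_trans (ler_normD _ _))// normr1 lerD2l.
have hC m k : `|P (m + k)%N - P m| <= B * U / (1 - r) * r ^+ m.
  have : `|P (m + k)%N - P m| <= B * U * \sum_(m <= j < m + k) r ^+ j.
    elim: k => [|k IH]; first by rewrite addn0 subrr normr0 big_geq// mulr0.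
    rewrite addnS big_nat_recr/= ?leq_addr// mulrDr.
    have -> : P (m + k).+1 - P m = (P (m + k)%N - P m) + P (m + k)%N * u (m + k)%N.
      by rewrite /P big_nat_recr//=; ring.
    rewrite (le_trans (ler_normD _ _))// lerD// normrM -mulrA.
    by apply: ler_pM.
  move=> h; apply: (le_trans h); rewrite [X in _ <= X]mulrAC -[X in _ <= X]mulrA.
  by rewrite ler_wpM2l ?mulr_ge0// sum_expr_le.
have [l [Pl hl]] := Kcomplete r0 r1 hC.
exists l; split => // h.
have PJ0 : 0 < `|P J|.
  rewrite normr_gt0 /P prodf_seq_neq0; apply/allP => j.
  by rewrite mem_index_iota /= => /h.
(* The tail product has norm at least 1 - 1/2, so only the first [J] factors can make the limit
   vanish. *)
have low n : (J <= n)%N -> `|P J| / 2 <= `|P n|.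
  move=> Jn; rewrite /P (big_cat_nat _ Jn)//= normrM ler_wpM2l//.
  have s2 : \sum_(J <= j < n) `|u j| <= 2^-1.
    by apply: le_trans (sumJ n); apply: ler_sum => j _; exact: hu.
  apply: le_trans (@prod_ge_1Bsum u J n _).
    by rewrite half1B lerD2l lerN2.
  by rewrite (le_trans s2)// invf_le1// ler1n.
apply/eqP => l0; move: Pl; rewrite l0 => /cvgrPdist_lt.
have e0 : 0 < `|P J| / 2 by rewrite divr_gt0.
move/(_ _ e0) => [N _ NP].
have := NP (maxn N J) (leq_maxl _ _); rewrite sub0r normrN.
by move/(le_lt_trans (low _ (leq_maxr _ _))); rewrite ltxx.
Qed.

Lemma cvg_exprn (T : Type) (F : set_system T) (FF : Filter F) (f : T -> K)
  (x : K) n : f @ F --> x -> (fun t => f t ^+ n) @ F --> x ^+ n.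
Proof.
move=> fx; elim: n => [|n IH].
  by rewrite expr0; under eq_fun do rewrite expr0; exact: cvg_cst.
by rewrite exprS; under eq_fun do rewrite exprS; exact: cvgM.
Qed.

(** * Convergence, continuity and zeros of theta *)

Definition theta_partial (x p : K) (m : nat) : K :=
  \prod_(0 <= j < m) ((1 - x * p ^+ j) * (1 - p ^+ j.+1 / x)).

(** Expanding the factor leaves three monomials, each at most [X * r ^+ j]; hence the constant 3. *)
Lemma theta_factor_bound (X r x p : K) j : 1 <= X -> r < 1 -> x != 0 ->
  `|x| <= X -> `|x^-1| <= X -> `|p| <= r ->
  `|(1 - x * p ^+ j) * (1 - p ^+ j.+1 / x) - 1| <= 3 * X * r ^+ j.
Proof.
move=> X1 r1 x0 hx hx' hp.
have r0 : 0 <= r by apply: le_trans hp.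
have X0 : 0 <= X by apply: le_trans X1.
have -> : (1 - x * p ^+ j) * (1 - p ^+ j.+1 / x) - 1 =
    - (x * p ^+ j) + (- (p * x^-1 * p ^+ j) + p * p ^+ j * p ^+ j).
  by rewrite exprS; field.
have hj : `|p| ^+ j <= r ^+ j by rewrite lerXn2r// ?nnegrE.
have rj : r ^+ j <= 1 by rewrite exprn_ile1// ltW.
have -> : 3 * X * r ^+ j = X * r ^+ j + (X * r ^+ j + X * r ^+ j) by ring.
have rj0 : 0 <= r ^+ j by rewrite exprn_ge0.
rewrite (le_trans (ler_normD _ _))// lerD//.
  by rewrite normrN normrM normrX ler_pM.
rewrite (le_trans (ler_normD _ _))// lerD//.
  rewrite normrN !normrM normrX ler_pM// ?mulr_ge0// -[X]mul1r ler_pM//.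
  exact/ltW/(le_lt_trans hp).
rewrite !normrM normrX ler_pM ?mulr_ge0//; apply: le_trans X1.
rewrite -[1]mulr1 ler_pM ?exprn_ge0//; first exact/ltW/(le_lt_trans hp).
exact: le_trans rj.
Qed.

Lemma theta1_unif (X r : K) : 1 <= X -> 0 <= r -> r < 1 ->
  exists M J, forall x p : K, x != 0 ->
    `|x| <= X -> `|x^-1| <= X -> `|p| <= r ->
  [/\ theta_partial x p @ \oo --> theta1 x p,
    forall m, `|theta1 x p - theta_partial x p m| <= M * r ^+ m &
    (forall j, (j < J)%N -> (1 - x * p ^+ j) * (1 - p ^+ j.+1 / x) != 0) ->
     theta1 x p != 0].
Proof.
move=> X1 r0 r1; have X0 : 0 <= X by apply: le_trans X1.
have [M [J H]] := @infprod (3 * X) r (ltac:(by rewrite mulr_ge0)) r0 r1.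
exists M, J => x p x0 hx hx' hp.
pose u j := (1 - x * p ^+ j) * (1 - p ^+ j.+1 / x) - 1.
have [|l [h1 h2 h3]] := H u; first by move=> j; exact: theta_factor_bound.
have uE j : 1 + u j = (1 - x * p ^+ j) * (1 - p ^+ j.+1 / x).
  by rewrite addrC subrK.
have PE n : \prod_(0 <= j < n) (1 + u j) = theta_partial x p n.
  by apply: eq_bigr => j _; rewrite uE.
have thl : theta_partial x p @ \oo --> l.
  by rewrite -(funext PE).
have -> : theta1 x p = l by apply: (cvg_lim (@norm_hausdorff _ _)).
split=> // [m|hJ]; first by rewrite -PE.
by apply: h3 => j /hJ; rewrite uE.
Qed.

Lemma cvg_theta_partial (x p : K) : x != 0 -> `|p| < 1 ->
  theta_partial x p @ \oo --> theta1 x p.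
Proof.
move=> x0 p1.
have X1 : 1 <= 1 + `|x| + `|x^-1| by rewrite -addrA lerDl addr_ge0.
have [M [J H]] := theta1_unif X1 (normr_ge0 p) p1.
have [] // := H x p x0; first by rewrite addrAC lerDr addr_ge0.
by rewrite lerDr addr_ge0.
Qed.

Lemma cvg_theta1 (T : Type) (F : set_system T) (FF : Filter F) (f g : T -> K)
  (x p : K) : x != 0 -> `|p| < 1 -> f @ F --> x -> g @ F --> p ->
  (fun t => theta1 (f t) (g t)) @ F --> theta1 x p.
Proof.
move=> x0 p1 fx gp.
(* Strict bounds on [x], its inverse and [p] persist near the limit, so the uniform estimate covers
   [f t] and [g t]; a three-epsilon argument then compares with one partial product. *)
pose X := 1 + `|x| + `|x^-1|; pose r := (1 + `|p|) / 2.
have X1 : 1 <= X by rewrite /X -addrA lerDl addr_ge0.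
have r0 : 0 <= r by rewrite divr_ge0 ?addr_ge0.
have r1 : r < 1 by rewrite ltr_pdivrMr// mul1r -natr1 mulr1n ltrD2l.
have pr : `|p| < r.
  by rewrite ltr_pdivlMr// -natr1 mulr1n mulrDr mulr1 ltrD2r.
have fV : (fun t => (f t)^-1) @ F --> x^-1 by exact: cvgV.
have xX : `|x| < X by rewrite /X addrAC ltrDr ltr_wpDr.
have xX' : `|x^-1| < X by rewrite /X ltrDr ltr_wpDr.
have [M [J H]] := theta1_unif X1 r0 r1.
have [_ hx _] := H x p x0 (ltW xX) (ltW xX') (ltW pr).
apply/cvgrPdist_lt => e e0.
have e30 : 0 < e / 3 by rewrite divr_gt0.
have [N _ NP] := @geometric_small M r _ r0 r1 e30.
have {NP}hN : M * r ^+ N < e / 3.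
  have h := NP _ (leqnn _); apply: le_lt_trans h.
  by apply: real_ler_norm; rewrite ger0_real// (le_trans _ (hx N)).
have cF : (fun t => theta_partial (f t) (g t) N) @ F --> theta_partial x p N.
  rewrite /theta_partial.
  apply: cvg_big => [|j _]; first exact: mul_continuous.
  apply: cvgM; apply: cvgB; first exact: cvg_cst.
  - by apply: cvgM => //; exact: cvg_exprn.
  - exact: cvg_cst.
  - by apply: cvgM => //; exact: cvg_exprn.
near=> t.
have -> : theta1 x p - theta1 (f t) (g t) =
  (theta1 x p - theta_partial x p N) +
  (theta_partial x p N - theta_partial (f t) (g t) N) -
  (theta1 (f t) (g t) - theta_partial (f t) (g t) N) by ring.
have -> : e = e / 3 + e / 3 + e / 3 by field.
rewrite (le_lt_trans (ler_normB _ _))// ltrD//.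
  rewrite (le_lt_trans (ler_normD _ _))// ltrD//.
    exact: le_lt_trans (hx N) hN.
  near: t; by move/cvgrPdist_lt : cF; exact.
apply: le_lt_trans hN.
have [] // := H (f t) (g t).
- by near: t; exact: (cvgr_neq0 _ fx).
- apply/ltW; near: t; exact: (cvgr_norm_lt _ fx).
- apply/ltW; near: t; exact: (cvgr_norm_lt _ fV).
- apply/ltW; near: t; exact: (cvgr_norm_lt _ gp).
Unshelve. all: end_near.
Qed.

Lemma near_dnbhs_neq (x y : K) : \forall t \near x^', t != y.
Proof.
have [->|xy] := eqVneq x y.
  exact: nbhs_dnbhs_neq.
apply: nbhs_dnbhs.
have h : t - y @[t --> nbhs x] --> x - y.
  by apply: cvgB; [apply: cvg_id|exact: cvg_cst].
have := cvgr_neq0 _ h; rewrite subr_eq0 => /(_ _ xy).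
by apply: filterS => t; rewrite subr_eq0.
Qed.

(** Near [x] the same finite number [J] of factors decides nonvanishing, and each vanishes for at
    most two values of [t]. *)
Lemma near_theta1_neq0 (c x p : K) : c != 0 -> x != 0 -> `|p| < 1 ->
  \forall t \near x^', theta1 (c * t) p != 0.
Proof.
move=> c0 x0 p1; have cx0 : c * x != 0 by rewrite mulf_neq0.
pose X := 1 + `|c * x| + `|(c * x)^-1|.
have X1 : 1 <= X by rewrite /X -addrA lerDl addr_ge0.
have xX : `|c * x| < X by rewrite /X addrAC ltrDr ltr_wpDr.
have xX' : `|(c * x)^-1| < X by rewrite /X ltrDr ltr_wpDr.
have fx : c * t @[t --> nbhs x] --> c * x.
  by apply: cvgM; [exact: cvg_cst|apply: cvg_id].
have fV : (c * t)^-1 @[t --> nbhs x] --> (c * x)^-1 by exact: cvgV.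
have [M [J H]] := theta1_unif X1 (normr_ge0 p) p1.
have hfac (j : 'I_J) : \forall t \near x^', 
    (1 - (c * t) * p ^+ j) * (1 - p ^+ j.+1 / (c * t)) != 0.
  near=> t.
  have t0 : t != 0 by near: t; exact: near_dnbhs_neq.
  rewrite mulf_neq0//.
    have tn : t != (c * p ^+ j)^-1 by near: t; exact: near_dnbhs_neq.
    apply/eqP => h; case/eqP : tn.
    move/eqP : h; rewrite subr_eq0 => /eqP h.
    have cp : c * p ^+ j != 0.
      apply: contra_eq_neq h => /eqP; rewrite mulf_eq0 (negPf c0) /= => /eqP ->.
      by rewrite mulr0 oner_neq0.
    apply: (mulfI cp); rewrite divff// [RHS]h; ring.
  have tn : t != p ^+ j.+1 / c by near: t; exact: near_dnbhs_neq.
  rewrite subr_eq0; apply/eqP => h; case/eqP : tn.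
  apply: (mulfI c0); rewrite [RHS]mulrC divfK//.
  by apply: (mulIf (invr_neq0 (mulf_neq0 c0 t0))); rewrite -h divff ?mulf_neq0.
near=> t.
have [||||_ _] // := H (c * t) p.
- by near: t; apply: nbhs_dnbhs; exact: (cvgr_neq0 _ fx).
- apply/ltW; near: t; apply: nbhs_dnbhs; exact: (cvgr_norm_lt _ fx).
- apply/ltW; near: t; apply: nbhs_dnbhs; exact: (cvgr_norm_lt _ fV).
apply => j jJ.
suff : forall j : 'I_J, (1 - (c * t) * p ^+ j) * (1 - p ^+ j.+1 / (c * t)) != 0.
  by move/(_ (Ordinal jJ)).
by near: t; exact: filter_forall.
Unshelve. all: end_near.
Qed.

End Products.

(** * The finite Jacobi triple product *)

(** Both ends are added at once, so that induction on [n] enlarges the symmetric window of a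
    bilateral sum. *)
Fixpoint zbox (n : nat) : seq int :=
  if n is m.+1 then m.+1%:Z :: - m.+1%:Z :: zbox m else [:: 0].

Lemma mem_zbox n (j : int) : (j \in zbox n) = (`|j| <= n)%N.
Proof.
elim: n => [|n IH]; first by rewrite inE; lia.
by rewrite !inE IH; lia.
Qed.

Lemma zbox_uniq n : uniq (zbox n).
Proof.
elim: n => [|n IH] //=; rewrite inE !mem_zbox IH andbT.
by apply/andP; split; lia.
Qed.

Lemma sum_zbox_shift (V : comNzRingType) (G : int -> V) n :
  \sum_(j <- zbox n) G (j + 1) =
  \sum_(j <- zbox n) G j + G (n%:Z + 1) - G (- n%:Z).
Proof.
elim: n => [|n IH].
  by rewrite /= !big_seq1 oppr0 !add0r addrC addKr.
rewrite /= !big_cons IH.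
have -> : - n.+1%:Z + 1 = - n%:Z by lia.
have -> : n%:Z + 1 = n.+1%:Z by lia.
by ring.
Qed.

(** The exponent j(j-1)/2, which is a natural number for negative j as well. *)
Definition tri (j : int) : nat :=
  match j with Posz n => 'C(n, 2) | Negz n => 'C(n.+2, 2) end.

Lemma tri2 (j : int) : (2 * tri j)%:Z = j * (j - 1).
Proof.
have h n : (2 * 'C(n.+1, 2))%N = (n.+1 * n)%N.
  by elim: n => [|n IH] //; rewrite binS bin1 mulnDr IH; lia.
case: j => [[|n]|n] /=; first by [].
  by rewrite h; lia.
by rewrite h NegzE; lia.
Qed.

Section JacobiFinite.
Variables (K : fieldType) (p : K).
Hypothesis p0 : p != 0.
Hypothesis pX1 : forall n, 1 - p ^+ n.+1 != 0.

Definition qfact (n : nat) : K := \prod_(0 <= j < n) (1 - p ^+ j.+1).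

Lemma qfactS n : qfact n.+1 = qfact n * (1 - p ^+ n.+1).
Proof. by rewrite /qfact big_nat_recr. Qed.

(** The usual convention 1/(p;p)_k = 0 for k < 0, under which the recursion below holds at every
    integer, in particular across k = 0. *)
Definition iqfact (k : int) : K := if k is Posz n then (qfact n)^-1 else 0.

Lemma iqfact_rec (k : int) : iqfact (k - 1) = (1 - p ^ k) * iqfact k.
Proof.
case: k => [[|n]|n].
- by rewrite expr0z subrr mul0r.
- rewrite (_ : n.+1%:Z - 1 = n%:Z) /=; last by lia.
  by rewrite qfactS invfM mulrCA -exprnP divff ?mulr1.
- by rewrite (_ : Negz n - 1 = Negz n.+1) ?mulr0// !NegzE; lia.
Qed.

(** The last factor is the Gaussian binomial of 2m over m + j. *)
Definition jcoef (m : nat) (j : int) : K :=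
  (-1) ^ j * p ^+ tri j * (qfact (2 * m) * iqfact (m%:Z + j) * iqfact (m%:Z - j)).

(** The coefficient of x^j after multiplication by the next factor, which expands to 1 + p^(2m+1) -
    p^m x - p^(m+1)/x. *)
Lemma jcoef_rec m j : jcoef m.+1 j =
  (1 + p ^+ (2 * m).+1) * jcoef m j - p ^+ m * jcoef m (j - 1)
    - p ^+ m.+1 * jcoef m (j + 1).
Proof.
rewrite /jcoef.
pose A : int := m%:Z + j; pose B : int := m%:Z - j.
have -> : m.+1%:Z + j = A + 1 by rewrite /A; lia.
have -> : m.+1%:Z - j = B + 1 by rewrite /B; lia.
have -> : m%:Z + (j - 1) = A - 1 by rewrite /A; lia.
have -> : m%:Z - (j - 1) = B + 1 by rewrite /B; lia.
have -> : m%:Z + (j + 1) = A + 1 by rewrite /A; lia.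
have -> : m%:Z - (j + 1) = B - 1 by rewrite /B; lia.
rewrite -/A -/B.
have IA : iqfact A = (1 - p ^ (A + 1)) * iqfact (A + 1) by rewrite -iqfact_rec addrK.
have IB : iqfact B = (1 - p ^ (B + 1)) * iqfact (B + 1) by rewrite -iqfact_rec addrK.
rewrite (iqfact_rec A) (iqfact_rec B) IA IB.
have N1 : (-1 : K) != 0 by rewrite oppr_eq0 oner_neq0.
have -> : (-1 : K) ^ (j - 1) = - (-1) ^ j.
  by rewrite expfzDr// exprN1 invrN1 mulrN1.
have -> : (-1 : K) ^ (j + 1) = - (-1) ^ j.
  by rewrite expfzDr// expr1z mulrN1.
have -> : p ^+ tri (j + 1) = p ^+ tri j * p ^ j.
  rewrite !exprnP -expfzDr//; congr (p ^ _).
  by have := tri2 j; have := tri2 (j + 1); lia.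
have -> : p ^+ tri (j - 1) = p ^+ tri j * p ^ (1 - j).
  rewrite !exprnP -expfzDr//; congr (p ^ _).
  by have := tri2 j; have := tri2 (j - 1); lia.
rewrite mulnS add2n 2!qfactS.
have E1 : p ^+ m * p ^ (1 - j) = p ^ B * p.
  rewrite exprnP -expfzDr// -[X in _ = _ * X]expr1z -expfzDr//.
  by congr (p ^ _); rewrite /B; lia.
have E2 : p ^+ m.+1 * p ^ j = p ^ A * p.
  rewrite exprnP -expfzDr// -[X in _ = _ * X]expr1z -expfzDr//.
  by congr (p ^ _); rewrite /A; lia.
have E3 : p ^+ (2 * m).+1 = p ^ A * p ^ B * p.
  rewrite exprnP -[X in _ = _ * X]expr1z -!expfzDr//.
  by congr (p ^ _); rewrite /A /B; lia.
rewrite (exprS p (2 * m).+1) E3; clearbody A B.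
rewrite (expfzDr A 1)// (expfzDr B 1)// expr1z.
set a := p ^ A in E2 *; set b := p ^ B in E1 *.
set s := (-1) ^ j; set t := p ^+ tri j; set Q := qfact _.
set x := iqfact _; set y := iqfact _.
(* With a = p^(m+j) and b = p^(m-j), what remains is a polynomial identity in a, b, p whose left
   side is (1 - abp)(1 - abp^2). *)
transitivity (s * t * Q * x * y * ((1 + a * b * p) * (1 - a * p) * (1 - b * p)
  + (b * p) * (1 - a) * (1 - a * p) + (a * p) * (1 - b) * (1 - b * p))).
  by ring.
by rewrite -E1 -E2; ring.
Qed.

(** The window [M] stays fixed during the induction on [m]: coefficients beyond [m] vanish, so
    shifting the summation index by one costs no boundary term. *)
Lemma jacobi_finite x m M : x != 0 -> (m <= M)%N ->
  \prod_(0 <= j < m) ((1 - x * p ^+ j) * (1 - p ^+ j.+1 / x)) =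
  \sum_(j <- zbox M) jcoef m j * x ^ j.
Proof.
move=> x0; elim: m => [|m IH] mM.
  rewrite big_geq// (big_rem 0)/= ?mem_zbox// big_seq big1 ?addr0.
    by rewrite /jcoef /= /qfact !big_geq// invr1 !mulr1.
  move=> j; rewrite mem_rem_uniq ?zbox_uniq// inE => /andP[/eqP j0 _].
  by rewrite /jcoef !add0r; case: j j0 => [[|n]|n]//= _; rewrite !(mulr0, mul0r).
rewrite big_nat_recr//= IH; last exact: ltnW.
have jz j : (m < `|j|)%N -> jcoef m j = 0.
  move=> mj; rewrite /jcoef; have [j0|j0] := lerP 0 j.
    have : m%:Z - j < 0 by lia.
    by case: (m%:Z - j) => //= n _; rewrite !mulr0.
  have : m%:Z + j < 0 by lia.
  by case: (m%:Z + j) => //= n _; rewrite mulr0 mul0r mulr0.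
under [RHS]eq_bigr do rewrite jcoef_rec 2!mulrBl.
rewrite !sumrB.
have S1 : \sum_(j <- zbox M) p ^+ m * jcoef m (j - 1) * x ^ j =
    p ^+ m * x * \sum_(j <- zbox M) jcoef m j * x ^ j.
  have := sum_zbox_shift (fun j => p ^+ m * jcoef m (j - 1) * x ^ j) M.
  rewrite (_ : M%:Z + 1 - 1 = M%:Z) ?(jz M) ?(jz (- M%:Z - 1)); [|lia|lia|lia].
  rewrite !(mulr0, mul0r) addr0 subr0 => <-; rewrite mulr_sumr.
  by apply: eq_bigr => j _; rewrite addrK expfzDr// expr1z; ring.
have S2 : \sum_(j <- zbox M) p ^+ m.+1 * jcoef m (j + 1) * x ^ j =
    p ^+ m.+1 / x * \sum_(j <- zbox M) jcoef m j * x ^ j.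
  have := sum_zbox_shift (fun j => p ^+ m.+1 * jcoef m j * x ^ (j - 1)) M.
  rewrite (jz (M%:Z + 1)) ?(jz (- M%:Z)); [|lia|lia].
  rewrite !(mulr0, mul0r) addr0 subr0 => h; rewrite mulr_sumr.
  transitivity (\sum_(j <- zbox M) p ^+ m.+1 * jcoef m j * x ^ (j - 1)).
    by rewrite -h; apply: eq_bigr => j _; rewrite addrK.
  by apply: eq_bigr => j _; rewrite expfzDr// exprN1; ring.
have S0 : \sum_(j <- zbox M) (1 + p ^+ (2 * m).+1) * jcoef m j * x ^ j =
    (1 + p ^+ (2 * m).+1) * \sum_(j <- zbox M) jcoef m j * x ^ j.
  by rewrite mulr_sumr; apply: eq_bigr => j _; rewrite mulrA.
rewrite S0 S1 S2.
set S := \sum_(_ <- _) _.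
by rewrite mul2n -addnn !exprS exprD; field.
Qed.
End JacobiFinite.

(** * Dominated convergence for double series *)

Lemma sum_sub_uniq (T : eqType) (K : numDomainType) (f : T -> K) (s t : seq T) :
  (forall x, 0 <= f x) -> uniq s -> uniq t -> {subset s <= t} ->
  \sum_(x <- s) f x <= \sum_(x <- t) f x.
Proof.
move=> f0 us ut st.
have pst : perm_eq [seq x <- t | x \in s] s.
  apply: uniq_perm => //; first exact: filter_uniq.
  by move=> x; rewrite mem_filter; case xs : (x \in s) => //=; exact: st.
rewrite [X in _ <= X](bigID (mem s))/=.
rewrite -[in X in _ <= X + _]big_filter (perm_big _ pst)/=.
by rewrite lerDl sumr_ge0.
Qed.

Definition zbox2 (n : nat) : seq (int * int) :=
  [seq (i, j) | i <- zbox n, j <- zbox n].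

Lemma mem_zbox2 n (k : int * int) :
  (k \in zbox2 n) = (`|k.1| <= n)%N && (`|k.2| <= n)%N.
Proof.
rewrite -!mem_zbox; apply/allpairsP/idP => [[[i j] /= [hi hj ->]]|/andP[hi hj]].
  by rewrite hi hj.
by exists k; split=> //; case: k {hi hj}.
Qed.

Lemma zbox2_uniq n : uniq (zbox2 n).
Proof. by apply: allpairs_uniq => [||[i j] [i' j']]//; exact: zbox_uniq. Qed.

Section Tannery.
Variable K : numFieldType.
Hypothesis Kcomplete : geometric_complete K.
Local Notation h := (2^-1 : K).

Lemma half_lt1 : h < 1.
Proof. by rewrite invf_lt1// ltr1n. Qed.

Lemma sum_half_zbox n : \sum_(j <- zbox n) h ^+ `|j|%N = 3 - 2 * h ^+ n.
Proof.
elim: n => [|n IH]; first by rewrite /= big_seq1 /= expr0; ring.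
by rewrite /= !big_cons IH abszN /= exprS; field.
Qed.

Definition weight (k : int * int) : K := h ^+ `|k.1|%N * h ^+ `|k.2|%N.

Lemma weight_ge0 k : 0 <= weight k.
Proof. by rewrite mulr_ge0// exprn_ge0. Qed.

Lemma sum_weight n : \sum_(k <- zbox2 n) weight k = (3 - 2 * h ^+ n) ^+ 2.
Proof.
rewrite big_allpairs_dep /= expr2 -sum_half_zbox big_distrl/=.
by apply: eq_bigr => i _; rewrite big_distrr.
Qed.

(** A large box has mass below 9 and the box [N] has mass (3 - 2 h^N)^2; the difference is at most
    12 h^N. *)
Lemma sum_weight_tail N (s : seq (int * int)) : uniq s ->
  (forall k, k \in s -> k \notin zbox2 N) -> \sum_(k <- s) weight k <= 12 * h ^+ N.
Proof.
move=> us hs.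
pose M := (N + \max_(k <- s) (`|k.1| + `|k.2|))%N.
have sM : {subset zbox2 N ++ s <= zbox2 M}.
  move=> k; rewrite mem_cat !mem_zbox2 => /orP[|ks]; first by rewrite /M; lia.
  have := @leq_bigmax_seq _ s xpredT (fun k => (`|k.1| + `|k.2|)%N) k ks isT.
  move=> /= hb; apply/andP; split; apply: (leq_trans _ (leq_addl _ _)).
    by apply: leq_trans hb; exact: leq_addr.
  by apply: leq_trans hb; exact: leq_addl.
have u2 : uniq (zbox2 N ++ s).
  rewrite cat_uniq zbox2_uniq us andbT /=; apply/hasPn => k /hs //.
have := sum_sub_uniq weight_ge0 u2 (zbox2_uniq M) sM.
rewrite big_cat/= !sum_weight -lerBrDl => /le_trans; apply.
have h0 n : 0 <= h ^+ n by rewrite exprn_ge0.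
have h1 n : h ^+ n <= 1 by rewrite exprn_ile1// ltW// half_lt1.
have -> : 12 * h ^+ N = 3 ^+ 2 - (3 - 2 * h ^+ N) ^+ 2 + 4 * h ^+ N ^+ 2 by ring.
rewrite -[X in X <= _]addr0 lerD ?mulr_ge0 ?exprn_ge0// lerD2r lerXn2r ?nnegrE//.
  rewrite subr_ge0 (@le_trans _ _ 2) ?ler_nat//.
  by rewrite -[X in _ <= X]mulr1 ler_wpM2l.
by rewrite gerBl mulr_ge0.
Qed.

Lemma near_subset_seq (T : eqType) (s : nat -> seq T) (t : seq T) :
  (forall k, \forall m \near \oo, k \in s m) ->
  \forall m \near \oo, {subset t <= s m}.
Proof.
move=> hs; elim: t => [|k t IH]; first exact: nearW.
near=> m => x; rewrite inE => /predU1P[->|xt].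
  by near: m; exact: hs.
suff : {subset t <= s m} by apply.
by near: m.
Unshelve. all: end_near.
Qed.

(** Two exhaustions [s] and [s'] of the pairs of integers are allowed: the product of two Jacobi
    sums runs over squares, while its regrouping by parity runs over other sets. Comparing the two
    finite sums directly avoids naming an infinite double sum. *)
Lemma tannery (C : K) (t t' : nat -> int * int -> K) (s s' : nat -> seq (int * int)) :
  0 <= C ->
  (forall m k, `|t m k| <= C * weight k) ->
  (forall m k, `|t' m k| <= C * weight k) ->
  (forall k, (fun m => t m k - t' m k) @ \oo --> (0 : K)) ->
  (forall m, uniq (s m)) -> (forall m, uniq (s' m)) ->
  (forall k, \forall m \near \oo, k \in s m) ->
  (forall k, \forall m \near \oo, k \in s' m) ->
  (fun m => \sum_(k <- s m) t m k - \sum_(k <- s' m) t' m k) @ \oo --> (0 : K).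
Proof.
move=> C0 tC tC' tt' us us' hs hs'; apply/cvgrPdist_lt => e e0.
have e30 : 0 < e / 3 by rewrite divr_gt0.
have h0 : 0 <= h by [].
have [N _ NP] := geometric_small Kcomplete (C * 12) h0 half_lt1 e30.
have {NP}hN : C * (12 * h ^+ N) < e / 3.
  have := NP _ (leqnn _); rewrite ger0_norm ?mulr_ge0 ?exprn_ge0//.
  by rewrite mulrA.
(* Any dominated family may be cut down to the fixed box [N], where termwise convergence is
   enough. *)
have split_sum (f : int * int -> K) (r : seq (int * int)) : uniq r ->
    {subset zbox2 N <= r} -> (forall k, `|f k| <= C * weight k) ->
    `|\sum_(k <- r) f k - \sum_(k <- zbox2 N) f k| <= C * (12 * h ^+ N).
  move=> ur br fC.
  have pr : perm_eq [seq k <- r | k \in zbox2 N] (zbox2 N).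
    apply: uniq_perm; [exact: filter_uniq|exact: zbox2_uniq|].
    by move=> k; rewrite mem_filter; case kN: (k \in zbox2 N) => //=; exact: br.
  rewrite (bigID (mem (zbox2 N)))/=.
  rewrite -[in X in `|X + _ - _|]big_filter (perm_big _ pr)/=.
  rewrite addrC addKr -big_filter.
  apply: (le_trans (ler_norm_sum _ _ _)).
  apply: (@le_trans _ _ (\sum_(k <- [seq k <- r | k \notin zbox2 N]) C * weight k)).
    exact: ler_sum.
  rewrite -mulr_sumr ler_wpM2l// sum_weight_tail ?filter_uniq// => k.
  by rewrite mem_filter => /andP[].
have cB : (fun m => \sum_(k <- zbox2 N) (t m k - t' m k)) @ \oo --> (0 : K).
  rewrite [X in _ --> X](_ : 0 = \sum_(k <- zbox2 N) (0 : K)); last by rewrite big1.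
  apply: cvg_big => [|k _]; first exact: add_continuous.
  exact: tt'.
near=> m.
rewrite sub0r normrN.
have -> : \sum_(k <- s m) t m k - \sum_(k <- s' m) t' m k =
  (\sum_(k <- s m) t m k - \sum_(k <- zbox2 N) t m k) +
  (\sum_(k <- zbox2 N) (t m k - t' m k)) -
  (\sum_(k <- s' m) t' m k - \sum_(k <- zbox2 N) t' m k).
  by rewrite sumrB; ring.
have -> : e = e / 3 + e / 3 + e / 3 by field.
rewrite (le_lt_trans (ler_normB _ _))// ltrD//.
  rewrite (le_lt_trans (ler_normD _ _))// ltrD//.
    apply: le_lt_trans hN; apply: split_sum => //.
    near: m; exact: near_subset_seq.
  rewrite -normrN -sub0r.
  by near: m; move/cvgrPdist_lt : cB; exact.
apply: le_lt_trans hN; apply: split_sum => //.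
near: m; exact: near_subset_seq.
Unshelve. all: end_near.
Qed.
End Tannery.

(** * The three-term relation *)

Section Weierstrass.
Variable K : numFieldType.
Hypothesis Kcomplete : geometric_complete K.

(** The ratio of consecutive terms is Y r^n, which is at most 1 from some [N] on; up to [N] the
    power of [r] is at most 1. *)
Lemma quad_bound (r Y : K) : 0 <= r -> r < 1 -> 1 <= Y ->
  exists2 C, 0 <= C & forall n, r ^+ 'C(n, 2) * Y ^+ n <= C.
Proof.
move=> r0 r1 Y1; have Y0 : 0 <= Y by apply: le_trans Y1.
have [N _ NP] := geometric_small Kcomplete Y r0 r1 (@ltr01 K).
exists (Y ^+ N); first exact: exprn_ge0.
have step n : r ^+ 'C(n.+1, 2) * Y ^+ n.+1 = (r ^+ 'C(n, 2) * Y ^+ n) * (Y * r ^+ n).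
  by rewrite binS bin1 exprD exprS; ring.
have pos n : 0 <= r ^+ 'C(n, 2) * Y ^+ n by rewrite mulr_ge0 ?exprn_ge0.
have small n : (n <= N)%N -> r ^+ 'C(n, 2) * Y ^+ n <= Y ^+ N.
  move=> nN; apply: (@le_trans _ _ (Y ^+ n)).
    by rewrite ler_piMl ?exprn_ge0// exprn_ile1// ltW.
  by rewrite ler_weXn2l.
elim=> [|n IH]; first exact: small.
have [nN|Nn] := ltnP n N; first exact: small.
rewrite step; apply: le_trans IH; rewrite ler_piMr//.
have := NP n Nn; rewrite ger0_norm ?mulr_ge0 ?exprn_ge0//; exact: ltW.
Qed.

Lemma jacobi_term_bound (p z : K) : z != 0 -> `|p| < 1 ->
  exists2 C, 0 <= C & forall Q j,
    `|(-1) ^ j * p ^+ tri j * Q * z ^ j| <= C * `|Q| * 2^-1 ^+ `|j|%N.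
Proof.
move=> z0 p1; pose X := 1 + `|z| + `|z^-1|.
have X1 : 1 <= X by rewrite /X -addrA lerDl addr_ge0.
have zX : `|z| <= X by rewrite /X addrAC lerDr addr_ge0.
have zX' : `|z^-1| <= X by rewrite /X lerDr addr_ge0.
have X0 : 0 <= X by apply: le_trans X1.
(* Bounding with 2X in place of X leaves a spare factor 2^|j|, which turns boundedness into the
   decay 2^(-|j|). *)
have X21 : 1 <= 2 * X by apply: (le_trans X1); rewrite ler_peMl// ler1n.
have [C C0 hC] := quad_bound (normr_ge0 p) p1 X21.
exists C => // Q j.
have zj : `|z ^ j| <= X ^+ `|j|%N.
  case: j => n; rewrite ?NegzE -?exprnN ?abszN/= -?exprVn normrX.
    by rewrite lerXn2r// nnegrE.
  by rewrite lerXn2r// nnegrE.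
have pj : `|p| ^+ tri j <= `|p| ^+ 'C(`|j|, 2).
  apply: ler_wiXn2l => //; first exact: ltW.
  by case: j {zj} => n //=; rewrite [in X in (_ <= X)%N]binS leq_addr.
have sj : `|(-1 : K) ^ j| = 1.
  by case: j {zj pj} => n; rewrite ?NegzE -?exprnN ?normfV normrX normrN1 expr1n ?invr1.
rewrite !normrM sj mul1r normrX mulrAC.
rewrite [leRHS]mulrAC ler_wpM2r//.
apply: (@le_trans _ _ (`|p| ^+ 'C(`|j|, 2) * X ^+ `|j|)).
  by rewrite ler_pM ?exprn_ge0.
apply: le_trans (ler_wpM2r _ (hC `|j|%N)); last by rewrite exprn_ge0.
by rewrite -mulrA -exprMn mulrAC divff ?mul1r// pnatr_eq0.
Qed.

Section NonzeroNome.
Variable p : K.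
Hypothesis p0 : p != 0.
Hypothesis p1 : `|p| < 1.

Lemma one_sub_exp_neq0 n : 1 - p ^+ n.+1 != 0.
Proof.
rewrite subr_eq0; apply/eqP => /(congr1 Num.norm).
rewrite normr1 normrX => h.
have : `|p| ^+ n.+1 < 1 by rewrite exprn_ilt1.
by rewrite -h ltxx.
Qed.

Lemma qfact_cvg : exists2 c, c != 0 & qfact p @ \oo --> c.
Proof.
have [M [J H]] := infprod Kcomplete (@ler01 K) (normr_ge0 p) p1.
have [|l [hl _ l0]] := H (fun j => - p ^+ j.+1).
  move=> j; rewrite mul1r normrN normrX exprS ler_piMl ?exprn_ge0//; exact: ltW.
exists l; first by apply: l0 => j _; exact: one_sub_exp_neq0.
exact: hl.
Qed.

Lemma cvg_norm_bound (u : nat -> K) (l : K) : u @ \oo --> l ->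
  exists2 M, 0 <= M & forall n, `|u n| <= M.
Proof.
move=> ul; have /cvg_seq_bounded [M [Mr hM]] : cvgn u by apply/cvg_ex; exists l.
exists (`|M| + 1) => [|n]; first by rewrite addr_ge0.
apply: hM => //; apply: le_lt_trans (real_ler_norm Mr) _.
by rewrite ltrDl.
Qed.

Lemma iqfact_bound : exists2 M, 0 <= M & forall k, `|iqfact p k| <= M.
Proof.
have [c c0 hc] := qfact_cvg.
have /cvg_norm_bound [M M0 hM] : (fun n => (qfact p n)^-1) @ \oo --> c^-1.
  exact: cvgV.
by exists M => // -[n|n] //=; rewrite normr0.
Qed.

Lemma jcoef_bound (z : K) : z != 0 ->
  exists2 C, 0 <= C & forall m j,
    `|jcoef p m j * z ^ j| <= C * 2^-1 ^+ `|j|%N.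
Proof.
move=> z0; have [C C0 hC] := jacobi_term_bound z0 p1.
have [c c0 hc] := qfact_cvg.
have [M M0 hM] := cvg_norm_bound hc.
have [M' M'0 hM'] := iqfact_bound.
exists (C * (M * M' * M')) => [|m j]; first by rewrite !mulr_ge0.
apply: (le_trans (hC _ _)); rewrite ler_wpM2r ?exprn_ge0// ler_wpM2l//.
by rewrite !normrM !ler_pM ?mulr_ge0.
Qed.

Lemma iqfact_cvg (c : K) (j : int) : c != 0 -> qfact p @ \oo --> c ->
  (fun m : nat => iqfact p (m%:Z + j)) @ \oo --> c^-1.
Proof.
move=> c0 hc; have hV : (fun n => (qfact p n)^-1) @ \oo --> c^-1 by exact: cvgV.
apply/cvgrPdist_lt => e e0.
move/cvgrPdist_lt : hV => /(_ _ e0) [N _ NP].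
exists (N + `|j|)%N => // m /= Nm.
have -> : m%:Z + j = (absz (m%:Z + j))%:Z by lia.
by apply: NP => /=; lia.
Qed.

Lemma jcoef_cvg : exists c, forall j,
  (fun m => jcoef p m j) @ \oo --> (-1) ^ j * p ^+ tri j * c.
Proof.
(* The limit of the Gaussian binomials, with one factor for each of their three parts; it equals
   1/(p;p)_oo. *)
have [c c0 hc] := qfact_cvg; exists (c * c^-1 * c^-1) => j.
apply: cvgM; first exact: cvg_cst.
apply: cvgM; last exact: iqfact_cvg.
apply: cvgM; last exact: iqfact_cvg.
apply/cvgrPdist_lt => e e0.
move/cvgrPdist_lt : hc => /(_ _ e0) [N _ NP].
exists N => // m /= Nm; apply: NP => /=; lia.
Qed.

(** The A of the rank-2 form, [oddpart] being its B. With x = e^(iz) they truncate Jacobi's theta_2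
    and theta_3 of nome p, the former up to the factor p^(-1/4) x. *)
Definition evenpart (m : nat) (x : K) : K :=
  \sum_(j <- zbox m) p ^+ (2 * tri j) * x ^ (2 * j).
Definition oddpart (m : nat) (x : K) : K :=
  \sum_(j <- zbox m) p ^+ (`|j| ^ 2) * x ^ (2 * j).

(* Every pair of integers is (s + d, s - d) or (s + d, s - d + 1), according to
   the parity of its sum.  In the double series for theta (x y) theta (x / y)
   this substitution separates the powers of x from those of y. *)
Definition pair_even (k : int * int) : int * int := (k.1 + k.2, k.1 - k.2).
Definition pair_odd (k : int * int) : int * int := (k.1 + k.2, k.1 - k.2 + 1).

Lemma pair_term (x y c : K) (i j : int) : x != 0 -> y != 0 ->
  ((-1) ^ i * p ^+ tri i * c * (x * y) ^ i) *
  ((-1) ^ j * p ^+ tri j * c * (x / y) ^ j) =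
  c ^+ 2 * (-1) ^ (i + j) * p ^+ (tri i + tri j) * (x ^ (i + j) * y ^ (i - j)).
Proof.
move=> x0 y0; rewrite exprD !expfzDr ?oppr_eq0 ?oner_neq0//.
by rewrite !expfzMl -exprz_inv; ring.
Qed.

Lemma sign_even (s : int) : (-1 : K) ^ (2 * s) = 1.
Proof. by rewrite -exprz_exp (_ : (-1) ^ 2 = 1) ?exp1rz//; exact: (sqrr_sign K 1). Qed.

(** As i + j = 2s, the sign is 1, and the parallelogram law splits the quadratic exponent into a
    part in s and a part in d. *)
Lemma pair_term_even (x y c : K) k : x != 0 -> y != 0 ->
  ((-1) ^ (pair_even k).1 * p ^+ tri (pair_even k).1 * c * (x * y) ^ (pair_even k).1) *
  ((-1) ^ (pair_even k).2 * p ^+ tri (pair_even k).2 * c * (x / y) ^ (pair_even k).2) =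
  c ^+ 2 * ((p ^+ (2 * tri k.1) * x ^ (2 * k.1)) *
            (p ^+ (`|k.2| ^ 2) * y ^ (2 * k.2))).
Proof.
move=> x0 y0; case: k => s d; rewrite pair_term//=.
have -> : s + d + (s - d) = 2 * s by ring.
have -> : s + d - (s - d) = 2 * d by ring.
have -> : (tri (s + d) + tri (s - d) = 2 * tri s + `|d| ^ 2)%N.
  have := tri2 (s + d); have := tri2 (s - d); have := tri2 s.
  have : (`|d| ^ 2)%N%:Z = d * d by lia.
  lia.
by rewrite sign_even exprD; ring.
Qed.

Lemma pair_term_odd (x y c : K) k : x != 0 -> y != 0 ->
  ((-1) ^ (pair_odd k).1 * p ^+ tri (pair_odd k).1 * c * (x * y) ^ (pair_odd k).1) *
  ((-1) ^ (pair_odd k).2 * p ^+ tri (pair_odd k).2 * c * (x / y) ^ (pair_odd k).2) =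
  - c ^+ 2 * (x / y) * ((p ^+ (`|k.1| ^ 2) * x ^ (2 * k.1)) *
            (p ^+ (2 * tri k.2) * y ^ (2 * k.2))).
Proof.
move=> x0 y0; case: k => s d; rewrite pair_term//=.
have -> : s + d + (s - d + 1) = 2 * s + 1 by ring.
have -> : s + d - (s - d + 1) = 2 * d - 1 by ring.
have -> : (tri (s + d) + tri (s - d + 1) = `|s| ^ 2 + 2 * tri d)%N.
  have := tri2 (s + d); have := tri2 (s - d + 1); have := tri2 d.
  have : (`|s| ^ 2)%N%:Z = s * s by lia.
  lia.
rewrite !expfzDr ?oppr_eq0 ?oner_neq0// sign_even !expr1z exprN1 exprD; ring.
Qed.

Lemma theta_rank2 : exists c, forall x y : K, x != 0 -> y != 0 ->
  (fun m => c ^+ 2 * (evenpart m x * oddpart m y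
                      - x / y * (oddpart m x * evenpart m y))) @ \oo
    --> theta1 (x * y) p * theta1 (x / y) p.
Proof.
have [c hc] := jcoef_cvg; exists c => x y x0 y0.
have xy0 : x * y != 0 by rewrite mulf_neq0.
have xVy0 : x / y != 0 by rewrite mulf_neq0// invr_neq0.
have [C C0 hC] := jcoef_bound xy0.
have [C' C'0 hC'] := jcoef_bound xVy0.
pose t (m : nat) (k : int * int) :=
  (jcoef p m k.1 * (x * y) ^ k.1) * (jcoef p m k.2 * (x / y) ^ k.2).
pose t' (m : nat) (k : int * int) :=
  ((-1) ^ k.1 * p ^+ tri k.1 * c * (x * y) ^ k.1) *
  ((-1) ^ k.2 * p ^+ tri k.2 * c * (x / y) ^ k.2).
have hl z j (D : K) : (forall m j, `|jcoef p m j * z ^ j| <= D * 2^-1 ^+ `|j|%N) ->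
    `|(-1) ^ j * p ^+ tri j * c * z ^ j| <= D * 2^-1 ^+ `|j|%N.
  move=> hD; have hj : (fun m => jcoef p m j * z ^ j) @ \oo -->
      (-1) ^ j * p ^+ tri j * c * z ^ j by apply: cvgM => //; exact: cvg_cst.
  apply/ler_addgt0Pr => e e0.
  move/cvgrPdist_lt : hj => /(_ _ e0) [N _ /(_ N (leqnn N))] h.
  rewrite -(subrK (jcoef p N j * z ^ j) (_ * c * _)) addrC.
  by rewrite (le_trans (ler_normD _ _))// lerD// ltW.
have tt' k : (fun m => t m k - t' m k) @ \oo --> (0 : K).
  rewrite -(subrr (t' 0%N k)); apply: cvgB; last exact: cvg_cst.
  apply: cvgM; apply: cvgM => //; exact: cvg_cst.
(* The second exhaustion. A pair (i, j) is reached with s the integer half of i + j and d = i -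
   s. *)
pose s' m := [seq pair_even k | k <- zbox2 m] ++ [seq pair_odd k | k <- zbox2 m].
have us' m : uniq (s' m).
  rewrite cat_uniq !map_inj_uniq ?zbox2_uniq ?andbT/=.
  - apply/hasPn => _ /mapP[[i j] _ ->]; apply/mapP => -[[i' j'] _].
    rewrite /pair_even /pair_odd /= => -[]; lia.
  - by move=> [i j] [i' j']; rewrite /pair_odd /= => -[h1 h2]; congr (_, _); lia.
  - by move=> [i j] [i' j']; rewrite /pair_even /= => -[h1 h2]; congr (_, _); lia.
have hs' k : \forall m \near \oo, k \in s' m.
  exists (`|k.1| + `|k.2|).+1 => // m /= km; case: k km => i j /= km.
  have [s [hs|hs]] : exists s : int, i + j = s + s \/ i + j = s + s + 1.
    exists ((i + j) %/ 2)%Z; lia.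
    - rewrite mem_cat; apply/orP; left; apply/mapP; exists (s, i - s).
        by rewrite mem_zbox2 /=; lia.
      by rewrite /pair_even /=; congr (_, _); lia.
  rewrite mem_cat; apply/orP; right; apply/mapP; exists (s, i - s).
    by rewrite mem_zbox2 /=; lia.
  by rewrite /pair_odd /=; congr (_, _); lia.
have hs k : \forall m \near \oo, k \in zbox2 m.
  by exists (`|k.1| + `|k.2|)%N => // m /= km; rewrite mem_zbox2; lia.
have bnd (a b : K) (k : int * int) : `|a| <= C * 2^-1 ^+ `|k.1|%N ->
    `|b| <= C' * 2^-1 ^+ `|k.2|%N -> `|a * b| <= C * C' * weight K k.
  by move=> ha hb; rewrite normrM /weight mulrACA ler_pM.
have := @tannery K Kcomplete (C * C') t t' zbox2 s' (mulr_ge0 C0 C'0)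
  (fun m k => bnd _ _ k (hC m k.1) (hC' m k.2))
  (fun m k => bnd _ _ k (hl _ k.1 _ hC) (hl _ k.2 _ hC'))
  tt' zbox2_uniq us' hs hs'.
have tE m : \sum_(k <- zbox2 m) t m k =
    theta_partial (x * y) p m * theta_partial (x / y) p m.
  rewrite /theta_partial !(jacobi_finite p0 one_sub_exp_neq0 _ (leqnn m))//.
  rewrite /zbox2 big_allpairs_dep /= big_distrl /=.
  by apply: eq_bigr => i _; rewrite big_distrr.
have t'E m : \sum_(k <- s' m) t' m k = c ^+ 2 * (evenpart m x * oddpart m y
                      - x / y * (oddpart m x * evenpart m y)).
  rewrite big_cat/= !big_map /t'.
  under eq_bigr do rewrite pair_term_even//.
  under [X in _ + X]eq_bigr do rewrite pair_term_odd//.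
  rewrite -!mulr_sumr mulrBr mulNr mulNr -mulrA; congr (_ * _ - _ * (_ * _)).
    rewrite /zbox2 big_allpairs_dep /= big_distrl /=.
    by apply: eq_bigr => i _; rewrite big_distrr.
  rewrite /zbox2 big_allpairs_dep /= big_distrl /=.
  by apply: eq_bigr => i _; rewrite big_distrr.
under eq_fun do rewrite tE t'E.
have hth : (fun m => theta_partial (x * y) p m * theta_partial (x / y) p m) @ \oo
    --> theta1 (x * y) p * theta1 (x / y) p.
  by apply: cvgM; exact: cvg_theta_partial.
move=> h0; have := cvgB hth h0; rewrite subr0 => h1; apply: cvg_trans (h1 _).
apply: near_eq_cvg; near=> m; rewrite !fctE /=; ring.
Unshelve. all: end_near.
Qed.
End NonzeroNome.

Lemma weierstrass (p x y u v : K) : `|p| < 1 ->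
  x != 0 -> y != 0 -> u != 0 -> v != 0 ->
  theta1 (x * y) p * theta1 (x / y) p * (theta1 (u * v) p * theta1 (u / v) p) -
  theta1 (x * v) p * theta1 (x / v) p * (theta1 (u * y) p * theta1 (u / y) p) =
  x / v * (theta1 (v * y) p * theta1 (v / y) p * (theta1 (u * x) p * theta1 (u / x) p)).
Proof.
move=> p1 x0 y0 u0 v0.
(* The coefficient recursion uses negative powers of [p]; at p = 0 theta is 1 - z and the relation
   is checked directly. *)
have [p0|p0] := eqVneq p 0.
  have th (z : K) : z != 0 -> theta1 z p = 1 - z.
    move=> z0; have h : theta_partial z p @ \oo --> 1 - z.
      rewrite -(cvg_shiftS (theta_partial z p)).
      rewrite (_ : [sequence _]_n = fun=> 1 - z); first exact: cvg_cst.
      apply/funext => m /=; rewrite /theta_partial p0 big_nat_recl//= expr0 mulr1.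
      rewrite expr0n /= mul0r subr0 mulr1 big1 ?mulr1// => i _.
      by rewrite !expr0n /= mulr0 mul0r !subr0 mulr1.
    exact: (cvg_unique (@norm_hausdorff _ _) (cvg_theta_partial Kcomplete z0 p1) h).
  by rewrite !th ?mulf_neq0 ?invr_neq0//; field; rewrite x0 y0 v0.
have [c hc] := theta_rank2 p0 p1.
pose H m (z w : K) := c ^+ 2 * (evenpart p m z * oddpart p m w
                      - z / w * (oddpart p m z * evenpart p m w)).
have h1 : (fun m => H m x y * H m u v - H m x v * H m u y) @ \oo -->
  theta1 (x * y) p * theta1 (x / y) p * (theta1 (u * v) p * theta1 (u / v) p) -
  theta1 (x * v) p * theta1 (x / v) p * (theta1 (u * y) p * theta1 (u / y) p).
  by apply: cvgB; apply: cvgM; exact: hc.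
have h2 : (fun m => x / v * (H m v y * H m u x)) @ \oo -->
  x / v * (theta1 (v * y) p * theta1 (v / y) p * (theta1 (u * x) p * theta1 (u / x) p)).
  by apply: cvgM; [exact: cvg_cst|apply: cvgM; exact: hc].
rewrite (_ : (fun m => H m x y * H m u v - H m x v * H m u y) =
  (fun m => x / v * (H m v y * H m u x))) in h1.
  exact: (cvg_unique (@norm_hausdorff _ _) h1 h2).
(* [H m z w] is c^2 z times the determinant of the vectors (A/z, B) at z and at w, so this is the
   Pluecker relation for four plane vectors, exact at each [m]. *)
apply/funext => m; rewrite /H.
by field; rewrite x0 y0 v0.
Qed.
End Weierstrass.

(** * Telescoping at generic parameters *)

(** Up to the common factor [D], the difference of the two sides is X1 X2 times the second relation
    minus Y3 Y4 times the first; the right-hand sides, and with them [T], cancel. *)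
Lemma telescope_algebra (K : fieldType)
    (Q q X1 X2 X3 X4 X5 X6 X7 X8 X9 Y1 Y2 Y3 Y4 Y5 Y6
     Z1 Z2 Z3 Z4 Z5 Z6 Z7 Z8 Z9 T : K) :
  [&& X3 != 0, X4 != 0, X7 != 0, X8 != 0 & X9 != 0] ->
  [&& Y1 != 0, Y2 != 0, Y3 != 0, Y4 != 0, Y5 != 0 & Y6 != 0] ->
  [&& Z7 != 0, Z8 != 0 & Z9 != 0] ->
  Q * X9 * X8 * X7 ^+ 2 - q * Z4 ^+ 2 * Z5 * Z6 = Q * X2 ^+ 2 * X1 * T ->
  Q * X3 * X4 * X5 * X6 - q * Y5 * Y6 * X1 * Z3 = Q * X2 * T * Y3 * Y4 ->
  X9 * Z1 * X3 * Z2 * X4 / (X8 * Y5 * Y1 * Y6 * Y2) * Q *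
    (X1 * X2 * X3 * X4 / (X7 * X8 * Y1 * Y2) *
     (X5 * X6 * Y1 * Y2 / (X7 * X9 * Y3 * Y4)) - 1) =
  Z8 * Z1 * X3 * Z2 * X4 / (X8 * X3 * Z7 * X4 * Z9) * q *
    (X1 * X2 * X3 * X4 / (X7 * X8 * Y1 * Y2) *
     (X1 * Z3 * Z7 * Z9 / (X7 * Z8 * Y3 * Y4)) -
     Z4 * Z5 * X3 * X4 / (X7 * X8 * Y5 * Y6) *
     (Z4 * Z6 * Z7 * Z9 / (X7 * Z8 * Y1 * Y2))).
Proof.
move=> /and5P[X30 X40 X70 X80 X90] /and5P[Y10 Y20 Y30 Y40 /andP[Y50 Y60]].
move=> /and3P[Z70 Z80 Z90] A B.
pose D := Z1 * X3 * Z2 * X4 / (Y1 * Y2 * X8 ^+ 2 * X7 ^+ 2 * Y3 * Y4 * Y5 * Y6).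
transitivity (D * (X1 * X2 * (Q * X3 * X4 * X5 * X6)
                   - Q * X9 * X8 * X7 ^+ 2 * Y3 * Y4)).
  rewrite /D; field.
  by rewrite ?X30 ?X40 ?X70 ?X80 ?X90 ?Y10 ?Y20 ?Y30 ?Y40 ?Y50 ?Y60.
transitivity (D * (q * X1 ^+ 2 * X2 * Z3 * Y5 * Y6
                   - q * Z4 ^+ 2 * Z5 * Z6 * Y3 * Y4)).
  congr (_ * _).
  move/eqP : A; rewrite subr_eq => /eqP ->; move/eqP : B; rewrite subr_eq => /eqP ->.
  ring.
rewrite /D; field.
by rewrite ?X30 ?X40 ?X70 ?X80 ?Y10 ?Y20 ?Y30 ?Y40 ?Y50 ?Y60 ?Z70 ?Z80 ?Z90.
Qed.

Section EllipticTelescope.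
Variable K : numFieldType.
Hypothesis Kcomplete : geometric_complete K.
Hypothesis Ksqrt : forall a : K, exists s, s ^+ 2 = a.
Variables (a b q p : K).
Hypotheses (a0 : a != 0) (b0 : b != 0) (q0 : q != 0) (p1 : `|p| < 1).

(** All theta factors fall into four families indexed by the power of q, so that matching factors
    and checking denominators becomes integer arithmetic. *)
Let alpha (j : int) := theta1 (a * q ^ j) p.
Let beta (j : int) := theta1 (b * q ^ j) p.
Let gamma (j : int) := theta1 (a * q ^ j / b) p.
Let tau (j : int) := theta1 (q ^ j) p.

Lemma theta1_1 : theta1 1 p = 0.
Proof.
have h : theta_partial 1 p @ \oo --> (0 : K).
  rewrite -(cvg_shiftS (theta_partial 1 p)).
  rewrite (_ : [sequence _]_n = fun=> 0); first exact: cvg_cst.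
  apply/funext => m /=; rewrite /theta_partial big_nat_recl//= expr0 mulr1.
  by rewrite subrr !mul0r.
have h' := cvg_theta_partial Kcomplete (oner_neq0 K) p1.
exact: (cvg_unique (@norm_hausdorff _ _) h' h).
Qed.

Lemma ellnum_numE (z i : int) :
  ellnum_num z (a * q ^ (2 * i)) (b * q ^ i) q p =
  tau z * alpha (2 * i + z) * beta (i + 2) * gamma i.
Proof.
rewrite /ellnum_num /theta !big_cons big_nil !mulr1 /tau /alpha /beta /gamma.
have q2 : q ^+ 2 = q ^ 2 by [].
have -> : a * q ^ (2 * i) * q ^ z = a * q ^ (2 * i + z) by rewrite expfzDr// mulrA.
have -> : b * q ^ i * q ^+ 2 = b * q ^ (i + 2).
  by rewrite q2 [in RHS]expfzDr// [RHS]mulrA.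
have qi : q ^ i != 0 by rewrite expfz_neq0.
have i2 : q ^ (2 * i) = q ^ i * q ^ i by rewrite -expfzDr//; congr (_ ^ _); ring.
have -> : a * q ^ (2 * i) / (b * q ^ i) = a * q ^ i / b.
  by rewrite i2; field; rewrite b0 qi.
by rewrite !mulrA.
Qed.

Lemma ellnum_denE (z i : int) :
  ellnum_den z (a * q ^ (2 * i)) (b * q ^ i) q p =
  tau 1 * alpha (2 * i + 1) * beta (i + z + 1) * gamma (i + z - 1).
Proof.
rewrite /ellnum_den /theta !big_cons big_nil !mulr1 /tau /alpha /beta /gamma.
have qi : q ^ i != 0 by rewrite expfz_neq0.
have i2 : q ^ (2 * i) = q ^ i * q ^ i by rewrite -expfzDr//; congr (_ ^ _); ring.
have -> : a * q ^ (2 * i) * q = a * q ^ (2 * i + 1).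
  by rewrite expfzDr// expr1z mulrA.
have -> : b * q ^ i * q ^ (z + 1) = b * q ^ (i + z + 1).
  by rewrite -addrA [in RHS]expfzDr// mulrA.
have -> : a * q ^ (2 * i) * q ^ (z - 1) / (b * q ^ i) = a * q ^ (i + z - 1) / b.
  rewrite -(addrA i) [in RHS]expfzDr// i2; set w := q ^ (z - 1).
  by field; rewrite b0 qi.
by rewrite expr1z !mulrA.
Qed.

Lemma ellnumE (z i : int) :
  ellnum z (a * q ^ (2 * i)) (b * q ^ i) q p =
  tau z * alpha (2 * i + z) * beta (i + 2) * gamma i /
  (tau 1 * alpha (2 * i + 1) * beta (i + z + 1) * gamma (i + z - 1)).
Proof. by rewrite /ellnum ellnum_numE ellnum_denE. Qed.

Lemma ellwt_denE (k : int) : ellwt_den k a b q p =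
  alpha 1 * beta (k + 1) * beta (k + 2) * gamma (k - 1) * gamma k.
Proof.
by rewrite /ellwt_den /theta !big_cons big_nil mulr1 /alpha /beta /gamma expr1z !mulrA.
Qed.

Lemma ellwtE (k : int) : ellwt k a b q p =
  alpha (2 * k + 1) * beta 1 * beta 2 * gamma (-1) * gamma 0 /
  (alpha 1 * beta (k + 1) * beta (k + 2) * gamma (k - 1) * gamma k) * q ^ k.
Proof.
rewrite /ellwt ellwt_denE /ellwt_num /theta !big_cons big_nil !mulr1.
rewrite /alpha /beta /gamma expr0z mulr1 expr1z exprN1.
by rewrite (_ : q ^+ 2 = q ^ 2)// !mulrA.
Qed.

(** The three-term relation at x = q, y = 1, u = a q^(k+1), v = q^k; the choice y = 1 produces the
    squares. *)
Lemma theta_relation_wt (k : int) :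
  q ^ k * alpha (2 * k + 1) * alpha 1 * tau 1 ^+ 2
    - q * tau k ^+ 2 * alpha k * alpha (k + 2) =
  q ^ k * alpha (k + 1) ^+ 2 * tau (k + 1) * tau (1 - k).
Proof.
have Q0 : q ^ k != 0 by rewrite expfz_neq0.
have := weierstrass Kcomplete p1 q0 (oner_neq0 K)
  (mulf_neq0 (mulf_neq0 a0 Q0) q0) Q0.
rewrite !mulr1 !divr1.
have k2 : q ^ (2 * k) = q ^ k * q ^ k by rewrite -expfzDr//; congr (_ ^ _); ring.
have -> : a * q ^ k * q * q ^ k = a * q ^ (2 * k + 1).
  by rewrite expfzDr// k2 expr1z; ring.
have -> : a * q ^ k * q / q ^ k = a * q ^ 1 by rewrite expr1z; field.
have -> : q * q ^ k = q ^ (k + 1) by rewrite expfzDr// expr1z mulrC.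
have E : q / q ^ k = q ^ (1 - k) by rewrite expfzDr// expr1z invr_expz.
have -> : a * q ^ k * q * q = a * q ^ (k + 2).
  by rewrite expfzDr// (_ : q ^ 2 = q * q)//; ring.
have -> : a * q ^ k * q / q = a * q ^ k by rewrite mulfK.
have -> : a * q ^ k * q = a * q ^ (k + 1).
  by rewrite expfzDr// expr1z; ring.
rewrite {1}E -[q in theta1 q p]expr1z => /(congr1 ( *%R (q ^ k))) H.
apply/eqP; rewrite -subr_eq0; move/eqP : H; rewrite -subr_eq0.
by congr (_ == 0); rewrite /alpha /tau; field.
Qed.

(* Here the square root s of a turns the four arguments into a product and a
   quotient of the same two numbers, as the three-term relation requires. *)
Lemma theta_relation_num (k : int) :
  q ^ k * beta 2 * gamma 0 * tau 2 * alpha (2 * k + 2)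
    - q * beta (k + 1) * gamma (k - 1) * tau (k + 1) * alpha (k + 3) =
  q ^ k * alpha (k + 1) * tau (1 - k) * beta (k + 3) * gamma (k + 1).
Proof.
have [s sE] := Ksqrt a.
have s0 : s != 0 by apply: contra_neq a0 => s0; rewrite -sE s0 expr0n.
have Q0 : q ^ k != 0 by rewrite expfz_neq0.
have := @weierstrass _ Kcomplete p (s * q) (b * q / s)
  (s * q ^ k * q ^+ 2) (s * q ^ k) p1.
rewrite !mulf_neq0 ?invr_neq0 ?expf_neq0// => /(_ isT isT isT isT).
have k2 : q ^ (2 * k) = q ^ k * q ^ k by rewrite -expfzDr//; congr (_ ^ _); ring.
have q2 : q ^ 2 = q * q by [].
have q3 : q ^ 3 = q * q * q by rewrite -exprnP !exprS expr0; ring.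
have -> : s * q * (b * q / s) = b * q ^ 2 by rewrite q2; field.
have -> : s * q / (b * q / s) = a * q ^ 0 / b.
  by rewrite -sE expr0z; field; rewrite q0 s0 b0.
have -> : s * q ^ k * q ^+ 2 * (s * q ^ k) = a * q ^ (2 * k + 2).
  by rewrite expfzDr// k2 q2 -sE; ring.
have -> : s * q ^ k * q ^+ 2 / (s * q ^ k) = q ^ 2.
  by rewrite q2; field; rewrite s0 Q0.
have -> : s * q * (s * q ^ k) = a * q ^ (k + 1).
  by rewrite expfzDr// expr1z -sE; ring.
have E : s * q / (s * q ^ k) = q / q ^ k by field; rewrite s0 Q0.
have E' : q / q ^ k = q ^ (1 - k) by rewrite expfzDr// expr1z invr_expz.
have -> : s * q ^ k * q ^+ 2 * (b * q / s) = b * q ^ (k + 3).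
  by rewrite expfzDr// q3; field.
have -> : s * q ^ k * q ^+ 2 / (b * q / s) = a * q ^ (k + 1) / b.
  by rewrite expfzDr// expr1z -sE; field; rewrite q0 b0 s0.
have -> : s * q ^ k * (b * q / s) = b * q ^ (k + 1).
  by rewrite expfzDr// expr1z; field.
have -> : s * q ^ k / (b * q / s) = a * q ^ (k - 1) / b.
  by rewrite expfzDr// exprN1 -sE; field; rewrite q0 b0 s0.
have -> : s * q ^ k * q ^+ 2 * (s * q) = a * q ^ (k + 3).
  by rewrite expfzDr// q3 -sE; ring.
have -> : s * q ^ k * q ^+ 2 / (s * q) = q ^ (k + 1).
  by rewrite expfzDr// expr1z; field; rewrite s0 q0.
rewrite E {1}E'.
move=> /(congr1 ( *%R (q ^ k))) H.
apply/eqP; rewrite -subr_eq0; move/eqP : H; rewrite -subr_eq0.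
by congr (_ == 0); rewrite /alpha /beta /gamma /tau; field.
Qed.

Lemma ellnumE0 (z : int) : ellnum z a b q p =
  tau z * alpha z * beta 2 * gamma 0 /
  (tau 1 * alpha 1 * beta (z + 1) * gamma (z - 1)).
Proof.
by have := ellnumE z 0; rewrite mulr0 expr0z !mulr1 !add0r.
Qed.

Lemma ellnumE1 (z : int) : ellnum z (a * q ^+ 2) (b * q) q p =
  tau z * alpha (z + 2) * beta 3 * gamma 1 /
  (tau 1 * alpha 3 * beta (z + 2) * gamma z).
Proof.
have := ellnumE z 1; rewrite mulr1 expr1z (_ : q ^ 2 = q ^+ 2)// => ->.
by congr (_ * alpha _ * beta _ * _ / (_ * alpha _ * beta _ * gamma _)); lia.
Qed.

Lemma ellnum0S (k : nat) : ellnum k.+1 a b q p =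
  tau (k%:Z + 1) * alpha (k%:Z + 1) * beta 2 * gamma 0 /
  (tau 1 * alpha 1 * beta (k%:Z + 2) * gamma k).
Proof.
rewrite ellnumE0 -[k.+1]addn1 PoszD.
by congr (_ / (_ * beta _ * gamma _)); lia.
Qed.

Lemma ellnum1S (k : nat) : ellnum k.+1 (a * q ^+ 2) (b * q) q p =
  tau (k%:Z + 1) * alpha (k%:Z + 3) * beta 3 * gamma 1 /
  (tau 1 * alpha 3 * beta (k%:Z + 3) * gamma (k%:Z + 1)).
Proof.
rewrite ellnumE1 -[k.+1]addn1 PoszD.
by congr (_ * alpha _ * _ * _ / (_ * beta _ * _)); lia.
Qed.

Lemma ellnum2E (k : nat) : ellnum 2 (a * q ^+ (2 * k)) (b * q ^+ k) q p =
  tau 2 * alpha (2 * k%:Z + 2) * beta (k%:Z + 2) * gamma k /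
  (tau 1 * alpha (2 * k%:Z + 1) * beta (k%:Z + 3) * gamma (k%:Z + 1)).
Proof.
rewrite !exprnP PoszM ellnumE.
by congr (_ / (_ * beta _ * gamma _)); lia.
Qed.

Lemma ellwt1E : ellwt 1 a b q p =
  alpha 3 * beta 1 * beta 2 * gamma (-1) * gamma 0 /
  (alpha 1 * beta 2 * beta 3 * gamma 0 * gamma 1) * q.
Proof. by rewrite ellwtE expr1z. Qed.

Variable N : nat.
Hypothesis tau_neq0 : theta1 q p != 0.
Hypothesis neq0 : forall j : int, (`|j| <= 2 * N + 5)%N ->
  [/\ alpha j != 0, beta j != 0 & gamma j != 0].

Lemma telescope_term (k : nat) : (k <= N)%N ->
  ellwt k a b q p *
    (ellnum k.+1 a b q p * ellnum 2 (a * q ^+ (2 * k)) (b * q ^+ k) q p - 1) =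
  ellwt 1 a b q p *
    (ellnum k.+1 a b q p * ellnum k.+1 (a * q ^+ 2) (b * q) q p -
     ellnum k a b q p * ellnum k (a * q ^+ 2) (b * q) q p).
Proof.
move=> kN; rewrite ellnum2E ellnum0S ellnum1S ellnumE0 ellnumE1 ellwt1E ellwtE.
have nz j : (`|j| <= 2 * N + 5)%N -> (alpha j != 0) * (beta j != 0) * (gamma j != 0).
  by move=> /neq0[-> -> ->].
have t1 : tau 1 != 0 by rewrite /tau expr1z.
move: (theta_relation_wt k) (theta_relation_num k) nz t1.
move: alpha beta gamma tau => f1 f2 f3 f4 H1 H2 nz t1.
apply: (telescope_algebra _ _ _ _ _ H1 H2).
- by rewrite !nz ?t1//; lia.
- by rewrite !nz //; lia.
- by rewrite !nz //; lia.
Qed.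

Lemma telescoped_sum :
  lhs N (a, b, q, p) = rhs N (a, b, q, p).
Proof.
rewrite /lhs /rhs.
pose g (k : nat) := ellnum k a b q p * ellnum k (a * q ^+ 2) (b * q) q p.
transitivity (\sum_(0 <= k < N.+1) ellwt 1 a b q p * (g k.+1 - g k)).
  by apply: eq_big_nat => k /andP[_ kN]; exact: telescope_term.
(* The lower end vanishes: the elliptic number of 0 contains theta(1; p) = 0. *)
rewrite -mulr_sumr telescope_sumr// {2}/g ellnumE0 /tau expr0z theta1_1.
by rewrite !mul0r subr0 /g mulrA.
Qed.

Lemma generic_lhs_dom : lhs_dom N (a, b, q, p).
Proof.
have nz j : (`|j| <= 2 * N + 5)%N -> (alpha j != 0) * (beta j != 0) * (gamma j != 0).
  by move=> /neq0[-> -> ->].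
have t1 : tau 1 != 0 by rewrite /tau expr1z.
split=> // k kN; split.
- rewrite ellwt_denE; move: nz t1; move: alpha beta gamma tau => f1 f2 f3 f4 nz t1.
  by rewrite !mulf_neq0 ?nz//; lia.
- have := ellnum_denE k.+1 0; rewrite mulr0 expr0z !mulr1 => ->.
  move: nz t1; move: alpha beta gamma tau => f1 f2 f3 f4 nz t1.
  by rewrite !mulf_neq0 ?nz//; lia.
- rewrite !exprnP PoszM ellnum_denE.
  move: nz t1; move: alpha beta gamma tau => f1 f2 f3 f4 nz t1.
  by rewrite !mulf_neq0 ?nz//; lia.
Qed.

Lemma generic_rhs_dom : rhs_dom N (a, b, q, p).
Proof.
have nz j : (`|j| <= 2 * N + 5)%N -> (alpha j != 0) * (beta j != 0) * (gamma j != 0).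
  by move=> /neq0[-> -> ->].
have t1 : tau 1 != 0 by rewrite /tau expr1z.
split=> //; split.
- rewrite ellwt_denE; move: nz t1; move: alpha beta gamma tau => f1 f2 f3 f4 nz t1.
  by rewrite !mulf_neq0 ?nz//; lia.
- have := ellnum_denE N.+1 0; rewrite mulr0 expr0z !mulr1 => ->.
  move: nz t1; move: alpha beta gamma tau => f1 f2 f3 f4 nz t1.
  by rewrite !mulf_neq0 ?nz//; lia.
- have := ellnum_denE N.+1 1; rewrite mulr1 expr1z (_ : q ^ 2 = q ^+ 2)// => ->.
  move: nz t1; move: alpha beta gamma tau => f1 f2 f3 f4 nz t1.
  by rewrite !mulf_neq0 ?nz//; lia.
Qed.
End EllipticTelescope.

(** * Arbitrary parameters *)

Section Removable.
Variable K : numFieldType.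
Hypothesis Kcomplete : geometric_complete K.
Hypothesis Ksqrt : forall a : K, exists s, s ^+ 2 = a.
Local Notation params := (K * K * K * K)%type.

(** Among the factors free of a and b, only theta(q; p) occurs in a denominator. The bound 2n + 5
    exceeds every shift of q that occurs: 2k + 2, k + 3 and constants between -1 and 3. *)
Definition generic (n : nat) : set params :=
  [set w | admissible w /\
    let: (a, b, q, p) := w in
    theta1 q p != 0 /\
    forall j : int, (`|j| <= 2 * n + 5)%N ->
      [/\ theta1 (a * q ^ j) p != 0, theta1 (b * q ^ j) p != 0 &
          theta1 (a * q ^ j / b) p != 0]].

Lemma near_bounded_int (T : Type) (F : set_system T) (FF : Filter F)
    (M : nat) (P : int -> set T) :
  (forall j : int, \forall t \near F, P j t) ->
  \forall t \near F, forall j : int, (`|j| <= M)%N -> P j t.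
Proof.
move=> h.
have : \forall t \near F, forall i : 'I_(2 * M).+1, P (i%:Z - M%:Z) t.
  by apply: filter_forall => i; exact: h.
apply: filterS => t H j jM.
have jM' : (`|(j + M%:Z)%R| < (2 * M).+1)%N by lia.
have := H (Ordinal jM') => /=.
by rewrite (_ : (`|(j + M%:Z)%R|%N)%:Z - M%:Z = j)//; lia.
Qed.

(** With [p] fixed, q, then b, then a are moved in turn. Each condition then reads theta1 (c * t) p
    != 0 in the variable being moved, with [c] built from those already chosen, and there are
    finitely many of them. *)
Lemma generic_dense n (w : params) : admissible w ->
  ProperFilter (within (generic n) (nbhs w)).
Proof.
case: w => [[[a b] q] p] [a0 b0 q0 p1].
split; last exact: within_filter.
rewrite /within /= => -[[U V] /= [[[U1 U2] /= [[[A B] /= [hA hB] AB] hQ] U12] hP]] UV.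
have [q' [[Qq q'0] tq]] : exists q', (U2 q' /\ q' != 0) /\ theta1 q' p != 0.
  apply: (@filter_ex _ (q^')); near=> t; split; first split.
  - by near: t; exact: nbhs_dnbhs.
  - by near: t; exact: near_dnbhs_neq.
  - rewrite -[t]mul1r; near: t; apply: near_theta1_neq0 => //; exact: oner_neq0.
have qj j : q' ^ j != 0 by rewrite expfz_neq0.
have [b' [[Bb b'0] tb]] : exists b', (B b' /\ b' != 0) /\
    forall j : int, (`|j| <= 2 * n + 5)%N -> theta1 (q' ^ j * b') p != 0.
  apply: (@filter_ex _ (b^')); near=> t; split; first split.
  - by near: t; exact: nbhs_dnbhs.
  - by near: t; exact: near_dnbhs_neq.
  - near: t; apply: near_bounded_int => j; exact: near_theta1_neq0.
have [a' [[Aa a'0] [ta tab]]] : exists a', (A a' /\ a' != 0) /\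
    ((forall j : int, (`|j| <= 2 * n + 5)%N -> theta1 (q' ^ j * a') p != 0) /\
     (forall j : int, (`|j| <= 2 * n + 5)%N -> theta1 (q' ^ j / b' * a') p != 0)).
  apply: (@filter_ex _ (a^')); near=> t; split; split.
  - by near: t; exact: nbhs_dnbhs.
  - by near: t; exact: near_dnbhs_neq.
  - near: t; apply: near_bounded_int => j; exact: near_theta1_neq0.
  - near: t; apply: near_bounded_int => j; apply: near_theta1_neq0 => //.
    by rewrite mulf_neq0// invr_neq0.
apply: (UV (a', b', q', p)).
  split; last exact: (nbhs_singleton hP).
  by apply: U12; split => //; apply: AB.
split=> //; split=> // j hj; split.
- by rewrite mulrC ta.
- by rewrite mulrC tb.
- by rewrite mulrAC [_ / b' * _]mulrC mulrA mulrAC tab.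
Unshelve. all: end_near.
Qed.

(** * Continuity of both sides where no denominator vanishes *)

Section Continuity.
Context (T : Type) (F : set_system T) {FF : Filter F}.

Lemma cvg_exprz (f : T -> K) (x : K) (z : int) : x != 0 ->
  f @ F --> x -> (fun t => f t ^ z) @ F --> x ^ z.
Proof.
move=> x0 fx; case: z => n; first exact: cvg_exprn.
by rewrite NegzE -exprnN; apply: cvgV; [rewrite expf_neq0|exact: cvg_exprn].
Qed.

Lemma cvg_theta_cons (f g : T -> K) (fs : T -> seq K) (x p : K) xs :
  x != 0 -> `|p| < 1 -> f @ F --> x -> g @ F --> p ->
  (fun t => theta (fs t) (g t)) @ F --> theta xs p ->
  (fun t => theta (f t :: fs t) (g t)) @ F --> theta (x :: xs) p.
Proof.
move=> x0 p1 fx gp fxs; rewrite /theta big_cons.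
under eq_fun do rewrite big_cons.
by apply: cvgM => //; exact: (cvg_theta1 Kcomplete).
Qed.

Lemma cvg_theta_nil (g : T -> K) (p : K) :
  (fun t => theta [::] (g t)) @ F --> theta [::] p.
Proof.
by rewrite /theta big_nil; under eq_fun do rewrite big_nil; exact: cvg_cst.
Qed.



Variables (A B Q P : T -> K) (a b q p : K).
Hypotheses (Aa : A @ F --> a) (Bb : B @ F --> b) (Qq : Q @ F --> q) (Pp : P @ F --> p).
Hypotheses (a0 : a != 0) (b0 : b != 0) (q0 : q != 0) (p1 : `|p| < 1).

Lemma cvg_Mexpz (C : T -> K) (c : K) (z : int) : C @ F --> c ->
  (fun t => C t * Q t ^ z) @ F --> c * q ^ z.
Proof. by move=> Cc; apply: cvgM => //; exact: cvg_exprz. Qed.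

Let qz_neq0 z : q ^ z != 0. Proof. exact: expfz_neq0. Qed.

Let bV : (fun t => (B t)^-1) @ F --> b^-1. Proof. exact: cvgV. Qed.
Let bV0 : b^-1 != 0. Proof. by rewrite invr_neq0. Qed.
Let q2 : (fun t => Q t ^+ 2) @ F --> q ^+ 2. Proof. exact: cvg_exprn. Qed.
Let q20 : q ^+ 2 != 0. Proof. by rewrite expf_neq0. Qed.

(** The parameters are arbitrary functions along a filter, so the shifted pairs such as a q^(2k), b
    q^k are covered too. *)
Lemma cvg_ellnum (z : int) : ellnum_den z a b q p != 0 ->
  (fun t => ellnum z (A t) (B t) (Q t) (P t)) @ F --> ellnum z a b q p.
Proof.
move=> d0; apply: cvgM; last apply: cvgV => //.
- rewrite /ellnum_num.
  apply: cvg_theta_cons => //; first exact: cvg_exprz.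
  apply: cvg_theta_cons => //;
    [exact: mulf_neq0 a0 (qz_neq0 _)|exact: cvg_Mexpz Aa|].
  apply: cvg_theta_cons => //;
    [exact: mulf_neq0 b0 q20|exact: cvgM Bb q2|].
  apply: cvg_theta_cons => //;
    [exact: mulf_neq0 a0 bV0|exact: cvgM Aa bV|].
  exact: cvg_theta_nil.
- rewrite /ellnum_den.
  apply: cvg_theta_cons => //.
  apply: cvg_theta_cons => //;
    [exact: mulf_neq0 a0 q0|exact: cvgM Aa Qq|].
  apply: cvg_theta_cons => //;
    [exact: mulf_neq0 b0 (qz_neq0 _)|exact: cvg_Mexpz Bb|].
  apply: cvg_theta_cons => //;
    [exact: mulf_neq0 (mulf_neq0 a0 (qz_neq0 _)) bV0|exact: cvgM (cvg_Mexpz Aa) bV|].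
  exact: cvg_theta_nil.
Qed.

Lemma cvg_ellwt (k : int) : ellwt_den k a b q p != 0 ->
  (fun t => ellwt k (A t) (B t) (Q t) (P t)) @ F --> ellwt k a b q p.
Proof.
have qV : (fun t => (Q t)^-1) @ F --> q^-1 by exact: cvgV.
have qV0 : q^-1 != 0 by rewrite invr_neq0.
move=> d0; apply: cvgM; last exact: cvg_exprz.
rewrite /ellwt_num; rewrite /ellwt_den in d0 *.
apply: cvgM; last apply: cvgV => //.
- apply: cvg_theta_cons => //;
    [exact: (mulf_neq0 a0 (qz_neq0 _))|exact: (cvg_Mexpz Aa)|].
  apply: cvg_theta_cons => //;
    [exact: (mulf_neq0 b0 q0)|exact: (cvgM Bb Qq)|].
  apply: cvg_theta_cons => //;
    [exact: (mulf_neq0 b0 q20)|exact: (cvgM Bb q2)|].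
  apply: cvg_theta_cons => //;
    [exact: (mulf_neq0 (mulf_neq0 a0 qV0) bV0)|exact: (cvgM (cvgM Aa qV) bV)|].
  apply: cvg_theta_cons => //;
    [exact: (mulf_neq0 a0 bV0)|exact: (cvgM Aa bV)|].
  exact: cvg_theta_nil.
- apply: cvg_theta_cons => //;
    [exact: (mulf_neq0 a0 q0)|exact: (cvgM Aa Qq)|].
  apply: cvg_theta_cons => //;
    [exact: (mulf_neq0 b0 (qz_neq0 _))|exact: (cvg_Mexpz Bb)|].
  apply: cvg_theta_cons => //;
    [exact: (mulf_neq0 b0 (qz_neq0 _))|exact: (cvg_Mexpz Bb)|].
  apply: cvg_theta_cons => //;
    [exact: mulf_neq0 (mulf_neq0 a0 (qz_neq0 _)) bV0
    |exact: cvgM (cvg_Mexpz Aa) bV|].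
  apply: cvg_theta_cons => //;
    [exact: mulf_neq0 (mulf_neq0 a0 (qz_neq0 _)) bV0
    |exact: cvgM (cvg_Mexpz Aa) bV|].
  exact: cvg_theta_nil.
Qed.

End Continuity.

Section ContinuitySides.
Context (T : Type) (F : set_system T) {FF : Filter F}.
Variables (A B Q P : T -> K) (a b q p : K).
Hypotheses (Aa : A @ F --> a) (Bb : B @ F --> b) (Qq : Q @ F --> q) (Pp : P @ F --> p).
Hypotheses (a0 : a != 0) (b0 : b != 0) (q0 : q != 0) (p1 : `|p| < 1).

Lemma cvg_lhs n : lhs_dom n (a, b, q, p) ->
  (fun t => lhs n (A t, B t, Q t, P t)) @ F --> lhs n (a, b, q, p).
Proof.
move=> [_ hn]; rewrite /lhs big_mkord; under eq_fun do rewrite big_mkord.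
apply: cvg_big => [|k _]; first exact: add_continuous.
have [h1 h2 h3] := hn k (ltn_ord k).
apply: cvgM; first exact: cvg_ellwt.
apply: cvgB; last exact: cvg_cst.
apply: cvgM; first exact: cvg_ellnum.
apply: cvg_ellnum => //; rewrite ?mulf_neq0 ?expf_neq0//;
  by apply: cvgM => //; exact: cvg_exprn.
Qed.

Lemma cvg_rhs n : rhs_dom n (a, b, q, p) ->
  (fun t => rhs n (A t, B t, Q t, P t)) @ F --> rhs n (a, b, q, p).
Proof.
move=> [_ [h1 h2 h3]]; apply: cvgM; first apply: cvgM.
- exact: cvg_ellwt.
- exact: cvg_ellnum.
- apply: cvg_ellnum => //; rewrite ?mulf_neq0 ?expf_neq0//; apply: cvgM => //.
  exact: cvg_exprn.
Qed.
End ContinuitySides.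

(** * Values at removable singularities *)

Lemma params_eta (f : params -> K) :
  f = (fun v => f (v.1.1.1, v.1.1.2, v.1.2, v.2)).
Proof. by apply/funext => -[[[]]]. Qed.

(** At a point of [D] this is continuity; at a removable singularity the limit along [D] is
    restricted to the smaller set [G]. Both kinds of value thus become limits along [G]. *)
Lemma value_lim (D G : set params) (f : params -> K) (w : params) :
  ProperFilter (within G (nbhs w)) -> G `<=` D ->
  (D w -> f v @[v --> nbhs w] --> f w) -> makes_sense D f w ->
  f v @[v --> within G (nbhs w)] --> value D f w.
Proof.
move=> GF GD fc ms; rewrite /value; have [wD|wD] := boolP (w \in D).
  apply: cvg_trans (fc _); last exact: set_mem.
  move=> S hS; have hS' : nbhs w (f @^-1` S) by exact: hS.
  suff : nbhs w [set v | G v -> S (f v)] by [].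
  by apply: filterS hS' => v hv _; exact: hv.
case: ms => [/mem_set|]; first by rewrite (negPf wD).
move=> cf; apply: cvg_trans cf.
move=> S hS; have hS' : nbhs w [set v | D v -> S (f v)] by exact: hS.
suff : nbhs w [set v | G v -> S (f v)] by [].
by apply: filterS hS' => v hv /GD; exact: hv.
Qed.

(** Both values are limits along the same proper filter, on which the two formulas agree, so
    uniqueness of limits applies. *)
Lemma value_lhs_rhs (a b q p : K) n : a != 0 -> b != 0 -> q != 0 -> `|p| < 1 ->
  makes_sense (@lhs_dom K n) (@lhs K n) (a, b, q, p) ->
  makes_sense (@rhs_dom K n) (@rhs K n) (a, b, q, p) ->
  value (@lhs_dom K n) (@lhs K n) (a, b, q, p) =
  value (@rhs_dom K n) (@rhs K n) (a, b, q, p).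
Proof.
move=> a0 b0 q0 p1 hl hr.
have GF : ProperFilter (within (generic n) (nbhs (a, b, q, p))).
  exact: generic_dense.
have c1 : v.1 @[v --> nbhs (a, b, q, p)] --> nbhs (a, b, q) by exact: cvg_fst.
have c2 : v.1.1 @[v --> nbhs (a, b, q, p)] --> nbhs (a, b).
  exact: (cvg_comp _ fst c1 cvg_fst).
have cA : v.1.1.1 @[v --> nbhs (a, b, q, p)] --> a.
  exact: (cvg_comp _ fst c2 cvg_fst).
have cB : v.1.1.2 @[v --> nbhs (a, b, q, p)] --> b.
  exact: (cvg_comp _ snd c2 cvg_snd).
have cQ : v.1.2 @[v --> nbhs (a, b, q, p)] --> q.
  exact: (cvg_comp _ snd c1 cvg_snd).
have cP : v.2 @[v --> nbhs (a, b, q, p)] --> p by exact: cvg_snd.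
have GL : generic n `<=` @lhs_dom K n.
  by move=> [[[a' b'] q'] p'] [] [a'0 b'0 q'0 p'1] [tq h]; exact: generic_lhs_dom.
have GR : generic n `<=` @rhs_dom K n.
  by move=> [[[a' b'] q'] p'] [] [a'0 b'0 q'0 p'1] [tq h]; exact: generic_rhs_dom.
have GE v : generic n v -> lhs n v = rhs n v.
  by case: v => [[[a' b'] q'] p'] [[a'0 b'0 q'0 p'1] [tq h]]; exact: telescoped_sum.
have cl := @value_lim _ _ (@lhs K n) (a, b, q, p) GF GL.
have cr := @value_lim _ _ (@rhs K n) (a, b, q, p) GF GR.
apply: (cvg_unique (@norm_hausdorff _ _) (cl _ hl)).
  by rewrite [@lhs K n]params_eta => hD; exact: cvg_lhs.
apply: cvg_trans (cr _ hr).
  apply: near_eq_cvg; near=> v.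
  by apply/esym/GE; near: v; exact: near_withinT.
by rewrite [@rhs K n]params_eta => hD; exact: cvg_rhs.
Unshelve. all: end_near.
Qed.
End Removable.

Theorem theorem4 (R : realType) (a b q p : R[i])
    (ha : a != 0) (hb : b != 0) (hq : q != 0) (hp : `|p| < 1) (n : nat)
    (hlhs : makes_sense (@lhs_dom R[i] n) (@lhs R[i] n) (a, b, q, p))
    (hrhs : makes_sense (@rhs_dom R[i] n) (@rhs R[i] n) (a, b, q, p)) :
  value (@lhs_dom R[i] n) (@lhs R[i] n) (a, b, q, p) =
  value (@rhs_dom R[i] n) (@rhs R[i] n) (a, b, q, p).
Proof.
have sq (x : R[i]) : exists s : R[i], s ^+ 2 = x.
  by exists (sqrtc x); exact: sqr_sqrtc.
exact (value_lhs_rhs (@complex_geometric_complete R) sq ha hb hq hp hlhs hrhs).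
Qed.
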